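(* Let $G$ be a finitely generated group of weakly polynomial growth, let $\Gamma$ be a Cayley graph of $G$ (with respect to a finite generating set), and let $d\in[0,\infty)$. Then the vector space of harmonic functions $u:\Gamma\to\mathbb{R}$ with polynomial growth at most $d$ is finite dimensional.
   Context: Let $G$ be a finitely generated group and let $B_G(r)\subset G$ denote the ball of radius $r$ centered at the identity $e\in G$ with respect to some fixed word norm on $G$ (coming from a finite generating set). $G$ has weakly polynomial growth if for some $d'\in(0,\infty)$ one has $\liminf_{r\to\infty}|B_G(r)|/r^{d'}<\infty$. The Cayley graph $\Gamma$ of $G$ with respect to a finite generating set $S$ has vertex set $G$ and an edge joining $g$ to $gs$ for $g\in G$, $s\in S$; it is viewed as the geometric realization of a $1$-dimensional complex, with all edges of length $1$ and the path metric $\operatorname{dist}$. A function $u:\Gamma\to\mathbb{R}$ is harmonic if it is continuous, has constant derivative on each edge, and satisfies $\sum_{w}(u(w)-u(v))=0$ at every vertex $v$, the sum being over the vertices $w$ adjacent to $v$. The function $u$ has polynomial growth at most $d$ if there is a constant $A$ with $|u(x)|\le A(1+\operatorname{dist}(e,x))^d$ for all $x\in\Gamma$. *)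

(* Defs.v *)
From HB Require Import structures.
From mathcomp Require Import all_boot all_order all_algebra finmap.
From mathcomp Require Import all_classical all_reals all_analysis.

Set Implicit Arguments.
Unset Strict Implicit.
Unset Printing Implicit Defensive.

Import Order.TTheory GRing.Theory Num.Theory.
Import numFieldNormedType.Exports.

Local Open Scope classical_set_scope.
Local Open Scope ring_scope.

Section WordNorm.
Context {R : realType} {G : groupType}.
Implicit Types (S : {fset G}) (g : G).

Definition word_for S g (w : seq G) : Prop :=
  all (fun x => (x \in S) || ((x^-1)%g \in S)) w /\ (\prod_(x <- w) x)%g = g.

Definition generates S : Prop := forall g, exists w, word_for S g w.

(* When [S] generates [G] the infimum is over a nonempty set of natural
   numbers, hence it is the minimal length of a word representing [g]. *)
Definition word_norm S g : R := inf [set (size w)%:R | w in word_for S g].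

Definition word_ball S (r : R) : set G := [set g | word_norm S g <= r].

(* [counting] is the cardinality, with value +oo on infinite sets. *)
Definition weakly_polynomial_growth S : Prop :=
  exists2 d : R, 0 < d &
    (limf_einf (fun r : R => counting (word_ball S r) * ((r `^ d)^-1)%:E)
       (+oo%R : set_system R) < +oo)%E.

End WordNorm.

Arguments weakly_polynomial_growth R {G} S.

(* The geometric realization of the Cayley graph, as the disjoint union of its
   vertices and of its open edges; there is one edge, a copy of [0, 1] glued to
   [g] at 0 and to [g * s] at 1, for every [g] in [G] and [s] in [S]. *)
Inductive cayley (R : realType) (G : groupType) (S : {fset G}) : Type :=
| Vertex of G
| EdgePoint of G & S & {t : R | 0 < t < 1}.

Arguments Vertex R {G} S _.
Arguments EdgePoint {R G S} _ _ _.

Definition cayley_adjacent (G : groupType) (S : {fset G}) (v w : G) : Prop :=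
  exists2 s, s \in S & w = (v * s)%g \/ v = (w * s)%g.

Section CayleyGraph.
Context {R : realType} {G : groupType} {S : {fset G}}.
Local Notation Gamma := (cayley R S).
Implicit Types (x y : Gamma) (u : Gamma -> R).

(* The characteristic map of the edge [(g, s)]. Only its values for [t] in
   [0, 1] are meaningful; elsewhere it is extended by constants. *)
Definition edge (g : G) (s : S) (t : R) : Gamma :=
  if insub t is Some t' then EdgePoint g s t'
  else Vertex R S (if t <= 0 then g else (g * val s)%g).

(* [pl_path x y l]: some piecewise linear path from [x] to [y], that is a
   concatenation of segments of closed edges, has length [l]. *)
Inductive pl_path : Gamma -> Gamma -> R -> Prop :=
| pl_path_nil x : pl_path x x 0
| pl_path_cons g s a b y l : 0 <= a <= 1 -> 0 <= b <= 1 ->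
    pl_path (edge g s b) y l -> pl_path (edge g s a) y (`|a - b| + l).

(* When [S] generates [G] any two points are joined by a path, so the infimum
   is over a nonempty set. *)
Definition cayley_dist x y : R := inf [set l | pl_path x y l].

Definition cayley_continuous u : Prop :=
  forall x (e : R), 0 < e -> exists2 r : R, 0 < r &
    forall y, cayley_dist x y < r -> `|u x - u y| < e.

Definition edgewise_constant_derivative u : Prop :=
  forall g s, exists c : R, forall t : R, 0 < t < 1 ->
    is_derive t 1 (fun t' : R => u (edge g s t')) c.

Definition cayley_harmonic u : Prop :=
  [/\ cayley_continuous u,
      edgewise_constant_derivative u &
      forall v : G,
        \sum_(w \in [set w | cayley_adjacent S v w])
          (u (Vertex R S w) - u (Vertex R S v)) = 0].

Definition polynomial_growth_at_most (d : R) u : Prop :=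
  exists A : R, forall x,
    `|u x| <= A * (1 + cayley_dist (Vertex R S 1%g) x) `^ d.

End CayleyGraph.

Arguments cayley_harmonic {R G} S u.
Arguments polynomial_growth_at_most {R G} S d u.

Definition finite_dimensional_subspace (R : realType) (E : lmodType R)
    (V : set E) : Prop :=
  submod_closed [in V] /\
  exists (n : nat) (b : 'I_n -> E),
    (forall i, V (b i)) /\
    forall v, V v -> exists c : 'I_n -> R, v = \sum_i c i *: b i.

(* Main.v *)
Require Import Defs.
From HB Require Import structures.
From mathcomp Require Import all_boot all_order all_algebra finmap.
From mathcomp Require Import all_classical all_reals all_analysis.
From mathcomp Require Import ring lra zify.

Set Implicit Arguments.
Unset Strict Implicit.
Unset Printing Implicit Defensive.

Import Order.TTheory GRing.Theory Num.Theory.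
Import numFieldNormedType.Exports.

Local Open Scope classical_set_scope.
Local Open Scope ring_scope.

(** The argument is Kleiner's, in the style of Colding and Minicozzi. A harmonic
    function on the Cayley graph is affine on each edge, hence determined by its
    values at the vertices, so everything takes place on the group: [B(r)] below
    is the ball of radius [r] about the identity, and [u] is harmonic when, at
    every [x], the sum of [u (x t) - u x] over the letters [t] vanishes.

    Two inequalities are opposed. The Poincare inequality [poincare] bounds the
    sum of the squares of a function of mean 0 on [B(r)] by [r^2] times its
    Dirichlet energy on [B(3r)], up to twice the ratio [|B(2r)| / |B(r)|];
    it holds on every group. The Caccioppoli inequality [caccioppoli] bounds the
    energy of a harmonic function on [B(r)] by a constant times [r^-2] times its
    sum of squares on [B(2r + 1)]. Cover [B(r2)] by [J] balls of radius [2 r1]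
    with controlled overlap: a harmonic [u] that has mean 0 on each of them satisfies
      sum of u^2 on B(r2)  <=  C (r1 / r2)^2  (sum of u^2 on B(8 r2)),
    which is [harmonic_decay]. So, on a space spanned by [n] harmonic functions,
    the form on the left is dominated by a tiny multiple of the one on the right
    on a subspace of codimension at most [J], and the Gram determinants of the
    two forms satisfy [det_gram_decay]:
      det Gram B(r2)  <=  (C (r1 / r2)^2)^(n - J)  det Gram B(8 r2).

    On the other hand, put [h i = ln |B(8^i)| + (ln det Gram B(8^i)) / n]. When
    the functions have polynomial growth and the group has weakly polynomial
    growth, [h i] is at most [A i + const] for arbitrarily large [i], with [A]
    independent of [n]. The pigeonhole principle [select_scales] then provides,
    for each [w], scales [i1] and [i2] with [i1 + w <= i2] at each of which one
    step of [h] costs at most [a = 6 A], while [h] grows by at most [a w] from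
    [i1] to [i2 + 1]. Take [r1 = 8^i1] and [r2 = 8^i2]. The constant [C] depends
    only on [a] and the number of letters, the number [J] of balls is at most
    [exp (a w)], and
    [det Gram B(8 r2) <= exp (a n) det Gram B(r2)]. Choosing [w] large in terms
    of [a], and then [n] twice an upper bound of [J], contradicts the displayed
    inequality. This bounds the rank of all the matrices of values [u_i (g_j)]
    ([harmonic_polynomial_growth_dependent]), and a space of functions with
    bounded ranks of values is finite dimensional
    ([finite_dimensional_of_rank]). *)

(** * Sums over duplicate-free sequences *)

Section SequenceSums.
Context {R : realDomainType}.

Lemma ler_sum_subseq (I : eqType) (s1 s2 : seq I) (F : I -> R) :
    uniq s1 -> uniq s2 -> {subset s1 <= s2} -> (forall i, 0 <= F i) ->
  \sum_(i <- s1) F i <= \sum_(i <- s2) F i.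
Proof.
move=> u1 u2 s12 F0.
have p : perm_eq s1 [seq i <- s2 | i \in s1].
  apply: uniq_perm => //; first exact: filter_uniq.
  move=> i; rewrite mem_filter.
  by case: (boolP (i \in s1)) => //= /s12 ->.
rewrite (perm_big _ p) /= big_filter [leRHS](bigID (mem s1)) /= lerDl.
exact: sumr_ge0.
Qed.

(** All the comparisons of sums over balls below are instances of this one: a
    translation is injective and maps a ball into a larger one. *)
Lemma ler_sum_inj (I J : eqType) (h : I -> J) (s1 : seq I) (s2 : seq J)
    (F : J -> R) :
    injective h -> uniq s1 -> uniq s2 -> {in s1, forall i, h i \in s2} ->
    (forall j, 0 <= F j) ->
  \sum_(i <- s1) F (h i) <= \sum_(j <- s2) F j.
Proof.
move=> hI u1 u2 s12 F0; rewrite -(big_map h xpredT).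
apply: ler_sum_subseq => //; first by rewrite map_inj_uniq.
by move=> j /mapP[i /s12 + ->].
Qed.

Lemma sumr_seq_const (I : Type) (s : seq I) (c : R) :
  \sum_(i <- s) c = (size s)%:R * c.
Proof. by rewrite big_const_seq count_predT iter_addr_0 mulr_natl. Qed.

End SequenceSums.

(** * Balls and the Dirichlet energy *)

Section Balls.
Context {G : groupType}.
Variable S : {fset G}.
Implicit Types (x y z t : G) (m n r : nat).

(** The neighbours of [g] in the Cayley graph are the [g t] for [t] a letter;
    each neighbour occurs once even if both [s] and its inverse are generators. *)
Definition letters : {fset G} := (S `|` [fset x^-1%g | x in S])%fset.

Lemma letterP t : reflect (t \in S \/ (t^-1)%g \in S) (t \in letters).
Proof.
rewrite inE; apply: (iffP orP) => [[->|]|[->|tS]]; [by left| |by left|right].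
  by case/imfsetP => x /= xS ->; right; rewrite invgK.
by apply/imfsetP; exists (t^-1)%g => //=; rewrite invgK.
Qed.

Lemma lettersV t : ((t^-1)%g \in letters) = (t \in letters).
Proof. by apply/letterP/letterP; rewrite invgK; case; [right|left|right|left]. Qed.

Fixpoint gball n : {fset G} :=
  if n is n'.+1 then (gball n' `|` [fset (x * t)%g | x in gball n', t in letters])%fset
  else [fset 1%g]%fset.

Lemma gballSP n x :
  reflect (x \in gball n \/ exists2 y, y \in gball n & (y^-1 * x)%g \in letters)
    (x \in gball n.+1).
Proof.
rewrite /= inE; apply: (iffP orP) => [[->|]|[->|[y yn yx]]].
- by left.
- by case/imfset2P => y yn [t tl ->]; right; exists y => //; rewrite mulKg.
- by left.
right; apply/imfset2P; exists y => //; exists (y^-1 * x)%g => //.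
by rewrite mulVKg.
Qed.

Lemma gball_mul_letter n x t : x \in gball n -> t \in letters -> (x * t)%g \in gball n.+1.
Proof. by move=> xn tl; apply/gballSP; right; exists x => //; rewrite mulKg. Qed.

Lemma gball_mono m n x : (m <= n)%N -> x \in gball m -> x \in gball n.
Proof.
move/subnK <-; elim: (n - m)%N => // k IH xm.
by rewrite addSn; apply/gballSP; left; apply: IH.
Qed.

Lemma gball1 n : 1%g \in gball n.
Proof. by apply: (@gball_mono 0) => //=; rewrite inE. Qed.

Lemma gballM m n x y : x \in gball m -> y \in gball n -> (x * y)%g \in gball (m + n).
Proof.
move=> xm; elim: n y => [|n IH] y.
  by rewrite /= inE addn0 => /eqP ->; rewrite mulg1.
rewrite addnS => /gballSP[/IH yn|[z /IH zn zy]]; apply/gballSP; first by left.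
by right; exists (x * z)%g => //; rewrite invgM -mulgA mulKg.
Qed.

Lemma gballV n x : x \in gball n -> (x^-1)%g \in gball n.
Proof.
elim: n x => [|n IH] x; first by rewrite /= !inE => /eqP ->; rewrite invg1.
case/gballSP => [/IH xn|[y /IH yn yx]]; first by apply/gballSP; left.
have -> : (x^-1 = (y^-1 * x)^-1 * y^-1)%g by rewrite invgM invgK mulgK.
rewrite -add1n; apply: gballM => //.
rewrite -[X in X \in _]mul1g; apply: gball_mul_letter; first exact: gball1.
by rewrite lettersV.
Qed.

Lemma gballVM m n x y : x \in gball m -> y \in gball n -> (x^-1 * y)%g \in gball (m + n).
Proof. by move=> xm yn; apply: gballM => //; apply: gballV. Qed.

Lemma card_gball_gt0 n : (0 < size (gball n))%N.
Proof. by move: (gball1 n); rewrite -[_ \in _]/(_ \in enum_fset _); case: (enum_fset _). Qed.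

Lemma card_gball_mono m n : (m <= n)%N -> (size (gball m) <= size (gball n))%N.
Proof.
by move=> mn; apply: uniq_leq_size => [|x]; [exact: fset_uniq|exact: gball_mono].
Qed.

Section Energy.
Context {R : realType}.
Implicit Type f : G -> R.

Definition energy f (A : seq G) : R :=
  \sum_(x <- A) \sum_(t <- letters) (f (x * t)%g - f x) ^+ 2.

Lemma energy_density_ge0 f x : 0 <= \sum_(t <- letters) (f (x * t)%g - f x) ^+ 2.
Proof. by apply: sumr_ge0 => t _; exact: sqr_ge0. Qed.

Lemma energy_ge0 f A : 0 <= energy f A.
Proof. by apply: sumr_ge0 => x _; exact: energy_density_ge0. Qed.

Lemma energy_gball_mono f m n : (m <= n)%N -> energy f (gball m) <= energy f (gball n).
Proof.
move=> mn; apply: ler_sum_subseq => //; [exact: fset_uniq|exact: fset_uniq| |].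
  by move=> x; exact: gball_mono.
by move=> x; exact: energy_density_ge0.
Qed.

(** Moving by [z] is moving [n] times by a letter, and each intermediate step
    is a right translation, hence sums to at most the energy on the larger ball.
    The induction on [n] replaces the Cauchy-Schwarz inequality over the [n]
    steps by [(p + q)^2 <= (1 + 1/n) p^2 + (n + 1) q^2]. *)
Lemma translation_energy f r n z : z \in gball n ->
  \sum_(x <- gball r) (f (x * z)%g - f x) ^+ 2 <= n%:R ^+ 2 * energy f (gball (r + n)).
Proof.
elim: n z => [|n IH] z.
  rewrite /= inE => /eqP ->; rewrite big1 ?expr0n ?mul0r // => x _.
  by rewrite mulg1 subrr expr0n.
have En : energy f (gball (r + n)) <= energy f (gball (r + n.+1)).
  by apply: energy_gball_mono; rewrite leq_add2l.
case/gballSP => [/IH /le_trans|[y yn yz]].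
  apply; apply: ler_pM => //; rewrite ?exprn_ge0 ?energy_ge0 //.
  by rewrite lerXn2r ?nnegrE // ler_nat.
set t := (y^-1 * z)%g in yz; have zE : z = (y * t)%g by rewrite mulVKg.
have step : \sum_(x <- gball r) (f (x * y * t)%g - f (x * y)%g) ^+ 2
    <= energy f (gball (r + n)).
  apply: (@le_trans _ _ (\sum_(x <- gball (r + n)) (f (x * t)%g - f x) ^+ 2)).
    apply: (@ler_sum_inj _ _ _ (fun x => x * y)%g _ _
      (fun x => (f (x * t)%g - f x) ^+ 2)) => //.
    - exact: mulIg.
    - exact: fset_uniq.
    - exact: fset_uniq.
    - by move=> x xr; apply: gballM.
    by move=> x; exact: sqr_ge0.
  apply: ler_sum => x _; rewrite (big_rem t) //= lerDl.
  by apply: sumr_ge0 => s _; exact: sqr_ge0.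
have [n0|n0] := posnP n.
  move: yn step; rewrite zE n0 /= inE => /eqP -> step.
  rewrite expr1n mul1r; apply: le_trans (le_trans step _); last first.
    by apply: energy_gball_mono; rewrite leq_add2l.
  by apply: ler_sum => x _; rewrite mul1g !mulg1.
apply: le_trans (_ : \sum_(x <- gball r)
  ((n.+1%:R / n%:R) * (f (x * y)%g - f x) ^+ 2 +
   n.+1%:R * (f (x * y * t)%g - f (x * y)%g) ^+ 2) <= _).
  apply: ler_sum => x _; rewrite zE mulgA.
  set p := f (x * y)%g - f x; set q := f (x * y * t)%g - f (x * y)%g.
  have -> : f (x * y * t)%g - f x = p + q by rewrite /p /q; ring.
  have nR : 0 < n%:R :> R by rewrite ltr0n.
  rewrite -subr_ge0 -[n.+1]addn1 natrD.
  have -> : (n%:R + 1) / n%:R * p ^+ 2 + (n%:R + 1) * q ^+ 2 - (p + q) ^+ 2 =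
     (p - n%:R * q) ^+ 2 / n%:R.
    by field; rewrite gt_eqF.
  by rewrite divr_ge0 ?sqr_ge0 ?ltW.
rewrite big_split /= -!mulr_sumr.
have nR : 0 < n%:R :> R by rewrite ltr0n.
apply: (@le_trans _ _ ((n.+1%:R / n%:R * n%:R ^+ 2 + n.+1%:R) * energy f (gball (r + n)))).
  rewrite mulrDl; apply: lerD; last by rewrite ler_wpM2l.
  by rewrite -mulrA ler_wpM2l ?IH // divr_ge0.
have -> : n.+1%:R / n%:R * n%:R ^+ 2 + n.+1%:R = n.+1%:R ^+ 2 :> R.
  by rewrite -[n.+1]addn1 natrD; field; rewrite gt_eqF.
by rewrite ler_wpM2l // exprn_ge0.
Qed.

(** For a function of mean 0 the sum of its squares is, up to the factor
    [2 |B(r)|], the sum of all [(f y - f x)^2] with [x] and [y] in the ball; writing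
    [y = x z] with [z] in [B(2r)] turns it into a sum of translation energies. *)
Lemma poincare f r : \sum_(x <- gball r) f x = 0 ->
  (size (gball r))%:R * \sum_(x <- gball r) f x ^+ 2 <=
  2 * r%:R ^+ 2 * (size (gball (2 * r)))%:R * energy f (gball (3 * r)).
Proof.
move=> f0; set B := gball r.
(* Expand the square; the cross term vanishes because the mean is 0. *)
have variance : \sum_(x <- B) \sum_(y <- B) (f y - f x) ^+ 2 =
    2 * ((size B)%:R * \sum_(x <- B) f x ^+ 2).
  transitivity (\sum_(x <- B) (\sum_(y <- B) f y ^+ 2 + (size B)%:R * f x ^+ 2)).
    apply: eq_bigr => x _; rewrite -sumr_seq_const -big_split /=.
    apply/eqP; rewrite -subr_eq0 -sumrB.
    rewrite (eq_bigr (fun y => - (2 * f x) * f y)) => [|y _]; last by ring.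
    by rewrite -mulr_sumr f0 mulr0.
  by rewrite big_split /= sumr_seq_const -mulr_sumr; ring.
have : \sum_(x <- B) \sum_(y <- B) (f y - f x) ^+ 2 <=
    \sum_(z <- gball (2 * r)) \sum_(x <- B) (f (x * z)%g - f x) ^+ 2.
  rewrite [leRHS]exchange_big /=.
  rewrite big_seq [leRHS]big_seq; apply: ler_sum => x xB.
  apply: le_trans (@ler_sum_inj _ _ _ (fun y => x^-1 * y)%g _ _
    (fun z => (f (x * z)%g - f x) ^+ 2) _ _ _ _ _) => //.
  - by under [leRHS]eq_bigr => y _ do rewrite mulVKg.
  - exact: mulgI.
  - exact: fset_uniq.
  - exact: fset_uniq.
  - by move=> y yB; rewrite mul2n -addnn; apply: gballVM.
  by move=> z; exact: sqr_ge0.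
rewrite variance => h.
have {h} := le_trans h _; move=> /(_ ((size (gball (2 * r)))%:R *
  ((2 * r)%:R ^+ 2 * energy f (gball (3 * r))))) h.
have {}h : 2 * ((size B)%:R * \sum_(x <- B) f x ^+ 2) <=
  (size (gball (2 * r)))%:R * ((2 * r)%:R ^+ 2 * energy f (gball (3 * r))).
  apply: h; rewrite -sumr_seq_const big_seq [leRHS]big_seq; apply: ler_sum => z zB.
  by have := translation_energy f r zB; rewrite -mulSn.
rewrite -(@ler_pM2l _ 2) //; apply: le_trans h _.
by rewrite natrM le_eqVlt; apply/orP; left; apply/eqP; ring.
Qed.

End Energy.

End Balls.

(** * Harmonic functions on the group *)

Section Caccioppoli.
Context {R : realType} {G : groupType}.
Variable S : {fset G}.
Local Notation gball := (gball S).
Local Notation letters := (letters S).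
Implicit Types (u : G -> R) (x y t : G).

Definition group_harmonic u := forall x, \sum_(t <- letters) (u (x * t)%g - u x) = 0.

Let adj x y : R := ((x^-1 * y)%g \in letters)%:R.

Let adj_sym x y : adj x y = adj y x.
Proof. by rewrite /adj -lettersV invgM invgK. Qed.

Let adj_ge0 x y : 0 <= adj x y. Proof. exact: ler0n. Qed.

(** Expressing sums over letters through the symmetric kernel [adj] makes
    summation by parts a mere exchange of the two sums over a ball. *)
Lemma sum_neighbours n (F : G -> R) x : x \in gball n ->
  \sum_(t <- letters) F (x * t)%g = \sum_(y <- gball n.+1) adj x y * F y.
Proof.
move=> xn; transitivity (\sum_(y <- gball n.+1 | (x^-1 * y)%g \in letters) F y).
  rewrite -(big_map (fun t => x * t)%g xpredT) -[RHS]big_filter.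
  apply: perm_big; apply: uniq_perm.
  - by rewrite map_inj_uniq ?fset_uniq //; exact: mulgI.
  - exact/filter_uniq/fset_uniq.
  move=> y; rewrite mem_filter; apply/mapP/andP => [[t tl ->]|[xy yn]].
    by rewrite mulKg; split=> //; apply: gball_mul_letter.
  by exists (x^-1 * y)%g => //; rewrite mulVKg.
rewrite big_mkcond; apply: eq_bigr => y _; rewrite /adj.
by case: ifP; rewrite ?mul1r ?mul0r.
Qed.

Lemma sum_adj_le (s : seq G) x : uniq s -> \sum_(y <- s) adj x y <= (size letters)%:R.
Proof.
move=> us; rewrite /adj -natr_sum ler_nat.
rewrite -big_mkcondr /= sum1_count -size_filter -(size_map (fun y => x^-1 * y)%g).
apply: uniq_leq_size.
  by rewrite map_inj_uniq ?filter_uniq //; exact: mulgI.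
by move=> z /mapP[y]; rewrite mem_filter => /andP[+ _] ->.
Qed.

(** The tent function equal to [m] up to radius [r + 1] and to 0 beyond [r + m],
    without division by [m] and without reference to the word length. *)
Definition cutoff r m x : R := \sum_(k < m) (x \in gball (r.+1 + k))%:R.

Lemma cutoff_inside r m x : x \in gball r.+1 -> cutoff r m x = m%:R.
Proof.
move=> xr; rewrite /cutoff (eq_bigr (fun=> 1)) => [|k _].
  by rewrite sumr_const card_ord.
by rewrite (gball_mono _ xr) // leq_addr.
Qed.

Lemma cutoff_outside r m x : x \notin gball (r + m) -> cutoff r m x = 0.
Proof.
move=> xr; rewrite /cutoff big1 // => k _.
case: (boolP (_ \in _)) => // /gball_mono xk; move: xr.
by rewrite xk // addSn -addnS leq_add2l.
Qed.

Lemma cutoff_lipschitz r m x y : (x^-1 * y)%g \in letters ->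
  (cutoff r m x - cutoff r m y) ^+ 2 <= 1.
Proof.
(* Neighbours of a point of radius [k] have radius at most [k + 1]: the sums
   defining the two cutoffs differ by a shift of one index. *)
have half x' y' : (x'^-1 * y')%g \in letters -> cutoff r m x' - cutoff r m y' <= 1.
  move=> xy; rewrite lerBlDr.
  apply: (@le_trans _ _ (\sum_(k < m) (y' \in gball (r.+1 + k.+1))%:R)).
    apply: ler_sum => k _; rewrite ler_nat.
    case: (boolP (x' \in _)) => // xk.
    by rewrite -[y'](mulVKg x') addnS gball_mul_letter.
  apply: (@le_trans _ _ (\sum_(k < m.+1) (y' \in gball (r.+1 + k))%:R)).
    by rewrite big_ord_recl /= lerDr ler0n.
  by rewrite big_ord_recr /= addrC lerD2r lern1 leq_b1.
move=> xy; have yx : (y^-1 * x)%g \in letters by rewrite -lettersV invgM invgK.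
have := half _ _ xy; have := half _ _ yx.
by move=> h1 h2; rewrite -ler_sqrt ?ltr01 // sqrtr_sqr sqrtr1 ler_norml; lra.
Qed.

(** Test harmonicity against [phi^2 u], with [phi] the cutoff. The algebraic
    identity, for [a, b] the values of [phi] and [p, q] those of [u],
      (a p - b q)^2 = (a - b)^2 p q + (a^2 p - b^2 q) (p - q)
    has a last term that sums to 0, and [(a - b)^2 <= 1]. *)
Lemma caccioppoli u r m : group_harmonic u ->
  m%:R ^+ 2 * energy S u (gball r) <=
  (size letters)%:R * \sum_(x <- gball (r + m).+1) u x ^+ 2.
Proof.
move=> hu; set B := gball (r + m).+1; set phi := cutoff r m.
(* The sum of [Z] is the pairing of [phi^2 u] with the Laplacian of [u]; [phi]
   vanishes on the last layer of [B], so that every neighbour is in [B]. *)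
pose Z x y := adj x y * (phi x ^+ 2 * u x * (u x - u y)).
have Z0 : \sum_(x <- B) \sum_(y <- B) Z x y = 0.
  apply: big1 => x _; have [xr|xr] := boolP (x \in gball (r + m)); last first.
    by apply: big1 => y _; rewrite /Z /phi cutoff_outside // expr0n /= !mul0r mulr0.
  transitivity (- (phi x ^+ 2 * u x) * \sum_(y <- B) adj x y * (u y - u x)).
    by rewrite mulr_sumr; apply: eq_bigr => y _; rewrite /Z; ring.
  by rewrite -(sum_neighbours (fun y => u y - u x) xr) hu mulr0.
have Z0' : \sum_(x <- B) \sum_(y <- B) Z y x = 0 by rewrite exchange_big.
apply: (@le_trans _ _ (\sum_(x <- B) \sum_(y <- B)
    adj x y * (phi x * u x - phi y * u y) ^+ 2)).
  apply: (@le_trans _ _ (\sum_(x <- gball r) \sum_(y <- B)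
    adj x y * (phi x * u x - phi y * u y) ^+ 2)); last first.
    apply: ler_sum_subseq; [exact: fset_uniq|exact: fset_uniq| |].
      by move=> x; apply: gball_mono; rewrite leqW ?leq_addr.
    by move=> x; apply: sumr_ge0 => y _; rewrite mulr_ge0 ?sqr_ge0.
  rewrite /energy mulr_sumr big_seq [leRHS]big_seq; apply: ler_sum => x xr.
  have xrm : x \in gball (r + m) by apply: gball_mono xr; rewrite leq_addr.
  rewrite (sum_neighbours (fun y => (u y - u x) ^+ 2) xrm) mulr_sumr.
  apply: ler_sum => y _; rewrite /adj.
  case: (boolP (_ \in letters)) => xy; last by rewrite !mul0r mulr0.
  have phim z : z \in gball r.+1 -> phi z = m%:R by exact: cutoff_inside.
  rewrite !mul1r (phim x) ?(phim y).
  - by rewrite le_eqVlt; apply/orP; left; apply/eqP; ring.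
  - by rewrite -(mulVKg x y) gball_mul_letter.
  by apply: gball_mono xr.
apply: (@le_trans _ _ (\sum_(x <- B) \sum_(y <- B)
    (adj x y * (u x ^+ 2 / 2) + adj y x * (u y ^+ 2 / 2)))).
  have -> : \sum_(x <- B) \sum_(y <- B) adj x y * (phi x * u x - phi y * u y) ^+ 2 =
      \sum_(x <- B) \sum_(y <- B) adj x y * ((phi x - phi y) ^+ 2 * (u x * u y)) +
      (\sum_(x <- B) \sum_(y <- B) Z x y + \sum_(x <- B) \sum_(y <- B) Z y x).
    rewrite -!big_split /=.
    apply: eq_bigr => x _; rewrite -!big_split /=; apply: eq_bigr => y _.
    by rewrite /Z (adj_sym y x); ring.
  rewrite Z0 Z0' !addr0.
  apply: ler_sum => x _; apply: ler_sum => y _.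
  rewrite (adj_sym y x) -mulrDr /adj.
  case: (boolP (_ \in letters)) => xy; last by rewrite !mul0r.
  rewrite !mul1r; have := @cutoff_lipschitz r m x y xy.
  rewrite -/phi; set c := (phi x - phi y) ^+ 2 => c1.
  have c0 : 0 <= c by exact: sqr_ge0.
  apply: (@le_trans _ _ (c * (u x ^+ 2 / 2 + u y ^+ 2 / 2))).
    rewrite ler_wpM2l //; have := sqr_ge0 (u x - u y); nra.
  by rewrite ler_piMl // addr_ge0 // divr_ge0 ?sqr_ge0.
under eq_bigr do rewrite big_split /=.
rewrite big_split /= [X in _ + X]exchange_big /= -big_split /=.
rewrite mulr_sumr; apply: ler_sum => x _.
rewrite -mulr_suml -mulrDr -splitr.
by rewrite ler_wpM2r ?sqr_ge0 // sum_adj_le // fset_uniq.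
Qed.

End Caccioppoli.

Section Covering.
Context {R : realType} {G : groupType}.
Variable S : {fset G}.
Local Notation gball := (gball S).
Local Notation letters := (letters S).
Implicit Types (u : G -> R) (x y t : G).

Definition separated_by k (X : seq G) :=
  {in X &, forall x y, x != y -> (x^-1 * y)%g \notin gball k}.

(** Greedy choice: a point is kept unless an earlier choice already covers it. *)
Lemma exists_net k (s : seq G) : exists X, [/\ uniq X, {subset X <= s}, separated_by k X
  & {in s, forall y, exists2 x, x \in X & (x^-1 * y)%g \in gball k}].
Proof.
elim: s => [|y s [X [uX Xs sX cX]]]; first by exists [::]; split.
have [/hasP[x xX xy]|/hasPn far] := boolP (has (fun x => (x^-1 * y)%g \in gball k) X).
  exists X; split=> //; first by move=> z /Xs zs; rewrite inE zs orbT.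
  by move=> z; rewrite inE => /predU1P[->|/cX //]; exists x.
exists (y :: X); split.
- rewrite /= uX andbT; apply/negP => /far.
  by rewrite mulVg gball1.
- move=> z; rewrite !inE => /predU1P[->|/Xs ->]; first by rewrite eqxx.
  by rewrite orbT.
- move=> a b; rewrite !inE => /predU1P[->|aX] /predU1P[->|bX] ab.
  + by rewrite eqxx in ab.
  + apply/negP => /gballV; rewrite invgM invgK; apply/negP; exact: far.
  + exact: far.
  exact: sX.
move=> z; rewrite inE => /predU1P[->|/cX[x xX xz]].
  by exists y; rewrite ?mem_head // mulVg gball1.
by exists x => //; rewrite inE xX orbT.
Qed.

(** The translates [x B(r)] are pairwise disjoint and contained in [g B(n + r)]. *)
Lemma packing r n g (X : seq G) : uniq X -> separated_by (2 * r) X ->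
    {in X, forall x, (g^-1 * x)%g \in gball n} ->
  (size X * size (gball r) <= size (gball (n + r)))%N.
Proof.
move=> uX sX Xn; rewrite -(size_allpairs (fun x b => g^-1 * (x * b))%g).
apply: uniq_leq_size.
  apply: allpairs_uniq => //; first exact: fset_uniq.
  move=> [x b] [y c] /allpairsP[[x1 b1] /= [xX bB [-> ->]]].
  move=> /allpairsP[[y1 c1] /= [yX cB [-> ->]]] /mulgI /= e.
  have [xy|xy] := eqVneq x1 y1; first by move: e; rewrite xy => /mulgI ->.
  have := sX _ _ xX yX xy.
  suff -> : (x1^-1 * y1 = b1 * c1^-1)%g.
    by rewrite mul2n -addnn gballM // gballV.
  by rewrite -[y1 in LHS](mulgK c1) -e !mulgA mulVg mul1g.
by move=> z /allpairsP[[x b] /= [xX bB ->]]; rewrite mulgA gballM ?Xn.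
Qed.

Lemma ler_sum_ball_translate q n x (F : G -> R) : (forall y, 0 <= F y) ->
  x \in gball n ->
  \sum_(b <- gball q) F (x * b)%g <=
  \sum_(y <- gball (n + q)) ((x^-1 * y)%g \in gball q)%:R * F y.
Proof.
move=> F0 xn.
apply: le_trans (@ler_sum_inj _ _ _ (fun b => x * b)%g _ (gball (n + q))
  (fun y => ((x^-1 * y)%g \in gball q)%:R * F y) _ _ _ _ _).
- rewrite big_seq [leRHS]big_seq; apply: ler_sum => b bq.
  by rewrite mulKg bq mul1r.
- exact: mulgI.
- exact: fset_uniq.
- exact: fset_uniq.
- by move=> b bq; apply: gballM.
by move=> y; rewrite mulr_ge0.
Qed.

(** A point lies in at most [K] of the balls [x B(q)], by [packing] around it. *)
Lemma sum_overlap r q n (K : R) (X : seq G) (F : G -> R) :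
    uniq X -> separated_by (2 * r) X -> {subset X <= gball n} ->
    (size (gball (q + r)))%:R <= K * (size (gball r))%:R -> (forall y, 0 <= F y) ->
  \sum_(x <- X) \sum_(b <- gball q) F (x * b)%g <= K * \sum_(y <- gball (n + q)) F y.
Proof.
move=> uX sX Xn hK F0.
apply: (@le_trans _ _ (\sum_(x <- X) \sum_(y <- gball (n + q))
    ((x^-1 * y)%g \in gball q)%:R * F y)).
  rewrite big_seq [leRHS]big_seq; apply: ler_sum => x xX.
  exact: ler_sum_ball_translate (Xn _ xX).
rewrite exchange_big /= mulr_sumr; apply: ler_sum => y _.
rewrite -mulr_suml ler_wpM2r //.
rewrite -natr_sum -big_mkcondr /= sum1_count -size_filter.
set X' := seq.filter _ X.
have rpos : 0 < (size (gball r))%:R :> R by rewrite ltr0n card_gball_gt0.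
rewrite -(ler_pM2r rpos) -natrM; apply: le_trans hK; rewrite ler_nat.
apply: (@packing r q y); first exact: filter_uniq.
  move=> a b; rewrite !mem_filter => /andP[_ aX] /andP[_ bX]; exact: sX.
move=> a; rewrite mem_filter => /andP[/= ay _].
by have := gballV ay; rewrite invgM invgK.
Qed.

Lemma sum_le_cover k n (X : seq G) (F : G -> R) : (forall y, 0 <= F y) ->
    {in gball n, forall y, exists2 x, x \in X & (x^-1 * y)%g \in gball k} ->
  \sum_(y <- gball n) F y <= \sum_(x <- X) \sum_(b <- gball k) F (x * b)%g.
Proof.
move=> F0 cX.
apply: (@le_trans _ _ (\sum_(x <- X) \sum_(y <- gball n)
    ((x^-1 * y)%g \in gball k)%:R * F y)).
  rewrite exchange_big /= big_seq [leRHS]big_seq; apply: ler_sum => y /cX[x xX xy].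
  rewrite -mulr_suml ler_peMl // (big_rem x) //= xy lerDl.
  by apply: sumr_ge0 => *; exact: ler0n.
apply: ler_sum => x _.
rewrite (bigID (fun y => (x^-1 * y)%g \in gball k)) /= addrC big1 ?add0r; last first.
  by move=> y /negbTE ->; rewrite mul0r.
rewrite -big_filter.
set s := seq.filter _ _.
have -> : \sum_(y <- s) ((x^-1 * y)%g \in gball k)%:R * F y =
    \sum_(y <- s) F (x * (x^-1 * y))%g.
  by apply: eq_big_seq => y; rewrite mem_filter mulVKg => /andP[-> _]; rewrite mul1r.
apply: (@ler_sum_inj _ _ _ (fun y => x^-1 * y)%g s (gball k) (fun b => F (x * b)%g)) => //.
- exact: mulgI.
- exact/filter_uniq/fset_uniq.
- exact: fset_uniq.
by move=> y; rewrite mem_filter => /andP[].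
Qed.

(** Poincare on each ball of the cover, bounded overlap, then Caccioppoli from
    [B(2 r2)] to [B(8 r2)]. The radius [8 r1] exceeds all those that occur near a
    centre: [2 r1] for the cover, [4 r1] in the doubling factor of Poincare, and
    [6 r1 + r1] for the overlap of the balls that carry the energy. *)
Lemma harmonic_decay r1 r2 (K : R) (X : seq G) u :
    (0 < r2)%N -> (6 * r1 <= r2)%N ->
    (size (gball (8 * r1)))%:R <= K * (size (gball r1))%:R ->
    uniq X -> separated_by (2 * r1) X -> {subset X <= gball r2} ->
    {in gball r2, forall y, exists2 x, x \in X & (x^-1 * y)%g \in gball (2 * r1)} ->
    group_harmonic S u ->
    {in X, forall x, \sum_(b <- gball (2 * r1)) u (x * b)%g = 0} ->
  \sum_(y <- gball r2) u y ^+ 2 <=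
  8 * K ^+ 2 * (size letters)%:R * (r1%:R / r2%:R) ^+ 2 *
    \sum_(y <- gball (8 * r2)) u y ^+ 2.
Proof.
move=> r20 r12 hK uX sX Xr2 cX hu u0.
have bpos n : 0 < (size (gball n))%:R :> R by rewrite ltr0n card_gball_gt0.
have K0 : 0 <= K.
  by rewrite -(pmulr_lge0 _ (bpos r1)); apply: le_trans hK; exact: ltW.
have hK' n : (n <= 8 * r1)%N -> (size (gball n))%:R <= K * (size (gball r1))%:R.
  by move=> n8; apply: le_trans hK; rewrite ler_nat card_gball_mono.
apply: le_trans (@sum_le_cover (2 * r1) r2 X (fun y => u y ^+ 2) _ cX) _.
  by move=> y; exact: sqr_ge0.
pose F y := \sum_(t <- letters) (u (y * t)%g - u y) ^+ 2.
have F0 y : 0 <= F y by exact: energy_density_ge0.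
apply: (@le_trans _ _ (8 * r1%:R ^+ 2 * K *
    \sum_(x <- X) \sum_(b <- gball (6 * r1)) F (x * b)%g)).
  rewrite mulr_sumr big_seq [leRHS]big_seq; apply: ler_sum => x xX.
  have := poincare (u0 x xX).
  rewrite -(ler_pM2l (bpos (2 * r1)%N)) => /le_trans; apply.
  have -> : energy S (fun b => u (x * b)%g) (gball (3 * (2 * r1))) =
      \sum_(b <- gball (6 * r1)) F (x * b)%g.
    rewrite mulnA; apply: eq_bigr => b _; apply: eq_bigr => t _.
    by rewrite mulgA.
  rewrite natrM.
  have -> : 2 * (2 * r1%:R) ^+ 2 * (size (gball (2 * (2 * r1))))%:R =
      8 * r1%:R ^+ 2 * (size (gball (2 * (2 * r1))))%:R :> R by ring.
  rewrite [leRHS]mulrA ler_wpM2r ?sumr_ge0 //.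
  rewrite [leRHS](_ : _ = 8 * r1%:R ^+ 2 * (K * (size (gball (2 * r1)))%:R)); last by ring.
  rewrite ler_wpM2l ?mulr_ge0 //.
  apply: le_trans (hK' _ _) _; first by rewrite mulnA leq_mul2r orbT.
  by rewrite ler_wpM2l // ler_nat card_gball_mono // leq_pmull.
apply: (@le_trans _ _ (8 * r1%:R ^+ 2 * K * (K * energy S u (gball (2 * r2))))).
  rewrite ler_wpM2l ?mulr_ge0 //.
  apply: le_trans (sum_overlap uX sX Xr2 (hK' _ _) F0) _; first by lia.
  rewrite ler_wpM2l //; apply: energy_gball_mono; lia.
have r2pos : 0 < r2%:R :> R by rewrite ltr0n.
have := @caccioppoli _ _ S u (2 * r2)%N r2 hu.
set E := energy _ _ _ => hE.
rewrite [leRHS](_ : _ = 8 * r1%:R ^+ 2 * K * (K * ((size letters)%:R *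
    (\sum_(y <- gball (8 * r2)) u y ^+ 2) / r2%:R ^+ 2))); last first.
  by field; rewrite gt_eqF.
rewrite ler_wpM2l ?mulr_ge0 // ler_wpM2l // ler_pdivlMr ?exprn_gt0 // mulrC.
apply: le_trans hE _; rewrite ler_wpM2l //.
apply: ler_sum_subseq; [exact: fset_uniq|exact: fset_uniq| |].
  by move=> x; apply: gball_mono; lia.
by move=> x; exact: sqr_ge0.
Qed.

End Covering.

(** * Determinants of comparable quadratic forms *)

Section QuadraticForms.
Context {R : realFieldType}.

Definition qform n (A : 'M[R]_n) (x : 'rV[R]_n) : R := (x *m A *m x^T) 0 0.

Definition posdef n (A : 'M[R]_n) : Prop :=
  A^T = A /\ forall x, x != 0 -> 0 < qform A x.

Lemma qform_congruence m n (P : 'M[R]_(m, n)) A x :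
  qform (P *m A *m P^T) x = qform A (x *m P).
Proof. by rewrite /qform trmx_mul !mulmxA. Qed.

Lemma posdef_unit n (A : 'M[R]_n) : posdef A -> A \in unitmx.
Proof.
move=> [_ A0]; rewrite unitmxE unitfE; apply/negP => /det0P[v v0 vA].
by have := A0 v v0; rewrite /qform vA mul0mx mxE ltxx.
Qed.

Lemma posdef_congruence n (P A : 'M[R]_n) : P \in unitmx -> posdef A ->
  posdef (P *m A *m P^T).
Proof.
move=> Pu [At A0]; split; first by rewrite !trmx_mul trmxK At mulmxA.
move=> x x0; rewrite qform_congruence; apply: A0.
by apply: contra_neq x0 => xP; rewrite -(mulmxK Pu x) xP mul0mx.
Qed.

Section SchurComplement.
Variables (n : nat) (A : 'M[R]_(1 + n)).
Hypothesis A_posdef : posdef A.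

Lemma qform_drsubmx x : qform (drsubmx A) x = qform A (row_mx 0 x).
Proof.
rewrite /qform -{2}(submxK A) mul_row_block tr_row_mx mul_row_col.
by rewrite !mul0mx !add0r trmx0 mulmx0 add0r.
Qed.

Lemma posdef_drsubmx : posdef (drsubmx A).
Proof.
have [At A0] := A_posdef; split; first by rewrite -{2}At trmx_drsub.
move=> x x0; rewrite qform_drsubmx; apply: A0.
by apply: contra_neq x0 => /eqP; rewrite row_mx_eq0 => /andP[_ /eqP].
Qed.

(** The vector [(1, schur_minimizer)] is orthogonal to the last [n] coordinates,
    hence minimizes the form among the [(1, z)]. *)
Definition schur_minimizer : 'rV[R]_n := - (ursubmx A *m invmx (drsubmx A)).

Definition schur_complement : R := qform A (row_mx 1%:M schur_minimizer).

Lemma schur_orthogonal :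
  exists s : 'M[R]_1, row_mx 1%:M schur_minimizer *m A = row_mx s 0.
Proof.
exists (ulsubmx A + schur_minimizer *m dlsubmx A).
rewrite -{1}(submxK A) mul_row_block !mul1mx.
rewrite /schur_minimizer [X in row_mx _ X](_ : _ = 0) //.
by rewrite mulNmx mulmxKV ?subrr // posdef_unit //; exact: posdef_drsubmx.
Qed.

(** Multiplying [A] on the left by the unipotent matrix whose first row is
    [(1, schur_minimizer)] makes it block lower triangular. *)
Lemma det_schur : \det A = schur_complement * \det (drsubmx A).
Proof.
have [s sE] := schur_orthogonal.
have -> : schur_complement = \det s.
  rewrite /schur_complement /qform sE tr_row_mx mul_row_col mul0mx addr0.
  by rewrite trmx1 mulmx1 det_mx11.
have e : block_mx 1%:M schur_minimizer 0 1%:M *m A =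
    block_mx s 0 (dlsubmx A) (drsubmx A).
  rewrite [LHS]mul_col_mx sE [RHS]/block_mx; congr col_mx.
  by rewrite -{1}(submxK A) mul_row_block !mul0mx !mul1mx !add0r.
have := congr1 determinant e.
by rewrite det_mulmx det_ublock det_lblock !det1 !mul1r.
Qed.

Lemma schur_complement_min z : schur_complement <= qform A (row_mx 1%:M z).
Proof.
have [s sE] := schur_orthogonal.
have [At A0] := A_posdef.
set v := row_mx 1%:M schur_minimizer; pose w := row_mx (0 : 'M[R]_1) (z - schur_minimizer).
have -> : row_mx 1%:M z = v + w.
  by rewrite /v /w add_row_mx addr0 addrC subrK.
have vw : v *m A *m w^T = 0.
  by rewrite sE tr_row_mx mul_row_col trmx0 mulmx0 mul0mx addr0.
have wv : w *m A *m v^T = 0.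
  by apply: trmx_inj; rewrite !trmx_mul trmxK At mulmxA vw trmx0.
rewrite /schur_complement /qform linearD /= mulmxDl !mulmxDr !mulmxDl vw wv.
rewrite addr0 add0r [leRHS]mxE lerDl.
have [->|w0] := eqVneq w 0; first by rewrite !mul0mx mxE.
exact/ltW/A0.
Qed.

Lemma schur_complement_gt0 : 0 < schur_complement.
Proof.
have [_ A0] := A_posdef; apply: A0; apply/negP; rewrite row_mx_eq0.
by rewrite -scalemx1 scaler_eq0 oner_eq0 /= => /andP[/eqP/matrixP/(_ 0 0)/eqP];
  rewrite !mxE oner_eq0.
Qed.

End SchurComplement.

(** The determinant is the product of the successive Schur complements, each of
    which is a minimum of the form over an affine subspace; so it is enough to
    compare the forms on vectors whose first coordinates vanish. *)
Lemma det_le_prod n (A B : 'M[R]_n) (c : 'I_n -> R) : posdef A -> posdef B ->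
    (forall i, 0 <= c i) ->
    (forall (i : 'I_n) (x : 'rV_n), (forall j : 'I_n, (j < i)%N -> x 0 j = 0) ->
      qform A x <= c i * qform B x) ->
  0 < \det A /\ \det A <= \prod_i c i * \det B.
Proof.
elim: n A B c => [|n IH] A B c pA pB c0 cAB.
  by rewrite big_ord0 !det_mx00 mul1r; split.
change 'M[R]_(1 + n) in A, B.
have [|dA dAB] := IH (drsubmx A) (drsubmx B) (fun i => c (lift 0 i))
  (posdef_drsubmx pA) (posdef_drsubmx pB) (fun i => c0 _).
  move=> i x xi; rewrite !qform_drsubmx; apply: cAB => j.
  case: (@split_ordP 1 n j) => k -> ki.
    by apply: etrans (row_mxEl _ _ _ _) _; rewrite mxE.
  by apply: etrans (row_mxEr _ _ _ _) _; apply: xi.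
have sA := schur_complement_gt0 pA.
rewrite (det_schur pA) (det_schur pB) big_ord_recl; split; first exact: mulr_gt0.
rewrite mulrACA; apply: ler_pM => //; try exact: ltW.
apply: le_trans (schur_complement_min pA (schur_minimizer B)) _.
by apply: cAB => j; rewrite ltn0.
Qed.

(** The equation [x *m L = 0] has rank at most [k]. In the basis that
    reduces [L] to its echelon form, vectors whose first [\rank L] coordinates
    vanish satisfy it, and [det_le_prod] applies. *)
Lemma det_le_expr n k (A B : 'M[R]_n) (L : 'M[R]_(n, k)) (c : R) :
    posdef A -> posdef B -> 0 <= c <= 1 ->
    (forall x, qform A x <= qform B x) ->
    (forall x, x *m L = 0 -> qform A x <= c * qform B x) ->
  0 < \det A /\ \det A <= c ^+ (n - k) * \det B.
Proof.
move=> pA pB /andP[c0 c1] AB cAB.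
have Cu : col_ebase L \in unitmx by exact: col_ebase_unit.
set P := invmx (col_ebase L); have Pu : P \in unitmx by rewrite unitmx_inv.
(* Rows of [P] of index at least [\rank L] span the kernel of [L]. *)
pose e (i : 'I_n) := if (i < \rank L)%N then 1 else c.
have [] := @det_le_prod n (P *m A *m P^T) (P *m B *m P^T) e.
- exact: posdef_congruence.
- exact: posdef_congruence.
- by move=> i; rewrite /e; case: ifP.
- move=> i x xi; rewrite !qform_congruence /e; case: ltnP => iL; first by rewrite mul1r.
  apply: cAB; rewrite -[L in _ *m L]mulmx_ebase -mulmxA !mulmxA.
  rewrite mulmxKV // [x *m _](_ : _ = 0) ?mul0mx //.
  apply/matrixP => a b; rewrite !mxE big1 // => j _; rewrite mxE ord1.
  have [ji|ij] := ltnP j i; first by rewrite xi // mul0r.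
  by rewrite [(j < _)%N]ltnNge (leq_trans iL ij) andbF mulr0.
have detC M : \det (P *m M *m P^T) = \det P ^+ 2 * \det M.
  by rewrite !det_mulmx det_tr; ring.
have P0 : 0 < \det P ^+ 2 by rewrite exprn_even_gt0 //= -unitfE -unitmxE.
rewrite !detC pmulr_rgt0 // => dA; rewrite mulrCA ler_pM2l // => dAB; split=> //.
have B0 : 0 <= \det B.
  have [//|i x _|dB _] := @det_le_prod n B B (fun=> 1) pB pB; last exact: ltW.
  by rewrite /= mul1r.
apply: le_trans dAB _; rewrite ler_wpM2r //.
have -> : \prod_i e i = c ^+ #|[pred i : 'I_n | ~~ (i < \rank L)%N]|.
  rewrite (bigID (fun i : 'I_n => (i < \rank L)%N)) /= big1 => [|i iL].
    rewrite mul1r -prodr_const; apply: eq_bigr => i /negbTE iL.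
    by rewrite /e iL.
  by rewrite /e iL.
apply: ler_wiXn2l => //.
have := cardC [pred i : 'I_n | (i < \rank L)%N]; rewrite card_ord.
set p := #|_|; set q := #|_| => pq.
have : (p <= k)%N.
  apply: leq_trans (rank_leq_col L); rewrite /p cardE -(size_map val).
  rewrite -[leqRHS](size_iota 0); apply: uniq_leq_size.
    by rewrite map_inj_uniq ?enum_uniq //; exact: val_inj.
  by move=> a /mapP[b]; rewrite mem_enum inE => bL ->; rewrite mem_iota.
by move: pq; lia.
Qed.

Lemma det_le_fact n (A : 'M[R]_n) (m : R) : (forall i j, `|A i j| <= m) ->
  \det A <= n`!%:R * m ^+ n.
Proof.
move=> Am; apply: le_trans (ler_norm _) _.
apply: le_trans (ler_norm_sum _ _ _) _.
rewrite -perm.card_Sn mulr_natl -sumr_const; apply: ler_sum => s _.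
rewrite normrM normrX normrN1 expr1n mul1r normr_prod.
apply: (@le_trans _ _ (\prod_(i < n) m)); last by rewrite prodr_const card_ord.
by apply: ler_prod => i _; rewrite normr_ge0 Am.
Qed.

End QuadraticForms.

Section GramMatrices.
Context {R : realType} {T : eqType} {n : nat}.
Variable u : 'I_n -> T -> R.
Implicit Types s : seq T.

Definition gram s : 'M[R]_n := \matrix_(a, b) \sum_(x <- s) u a x * u b x.

Definition combination (c : 'rV[R]_n) (x : T) : R := \sum_a c 0 a * u a x.

Lemma qform_gram s c : qform (gram s) c = \sum_(x <- s) combination c x ^+ 2.
Proof.
rewrite /qform mxE.
transitivity (\sum_(b < n) \sum_(x <- s) combination c x * (c 0 b * u b x)).
  apply: eq_bigr => b _; rewrite mxE [c^T _ _]mxE mulr_suml.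
  under eq_bigr => a _ do rewrite mxE mulr_sumr mulr_suml.
  rewrite exchange_big /=. apply: eq_bigr => x _.
  by rewrite /combination mulr_suml; apply: eq_bigr => a _; ring.
rewrite exchange_big /=; apply: eq_bigr => x _.
by rewrite -mulr_sumr expr2.
Qed.

(** If a combination vanishes on [s] then it vanishes at the [g i], and there the
    invertible matrix of values forbids it. *)
Lemma gram_posdef s (g : 'I_n -> T) : (forall i, g i \in s) ->
  \matrix_(i, j) u i (g j) \in unitmx -> posdef (gram s).
Proof.
move=> gs gu; split.
  by apply/matrixP => a b; rewrite !mxE; apply: eq_bigr => x _; rewrite mulrC.
move=> c c0; rewrite qform_gram lt_neqAle sumr_ge0 ?andbT; last first.
  by move=> x _; exact: sqr_ge0.
apply: contra_neq c0 => /esym/eqP; rewrite psumr_eq0; last first.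
  by move=> x _; exact: sqr_ge0.
move=> /allP c0; rewrite -(mulmxK gu c) [c *m _](_ : _ = 0) ?mul0mx //.
apply/matrixP => i j; rewrite !mxE ord1.
have /c0 : g j \in s by [].
rewrite /= sqrf_eq0 => /eqP e; rewrite -[RHS]e; by apply: eq_bigr => a _; rewrite mxE.
Qed.

End GramMatrices.

(** * Selection of scales *)

Section Scales.
Context {R : realType}.
Variables (h : nat -> R) (A C : R).
Hypothesis h_mono : forall i, h i <= h i.+1.

Lemma scale_mono i j : (i <= j)%N -> h i <= h j.
Proof. by move=> ij; apply: (homo_leq (@le_refl _ _) (@le_trans _ _)) ij. Qed.

Lemma slow_step j w b : (0 < w)%N -> h (j + w) - h j <= b * w%:R ->
  exists2 i, (j <= i < j + w)%N & h i.+1 - h i <= b.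
Proof.
move=> w0 hw; apply: contrapT => no.
have step i : (j <= i < j + w)%N -> b < h i.+1 - h i.
  by move=> ij; rewrite ltNge; apply/negP => hi; apply: no; exists i.
have : forall k, (k < w)%N -> b * k.+1%:R < h (j + k.+1) - h j.
  elim=> [|k IH] kw.
    by rewrite mulr1 addn1; apply: step; rewrite leqnn -[ltnLHS]addn0 ltn_add2l.
  have := IH (ltnW kw); have := step (j + k.+1)%N; rewrite leq_addr ltn_add2l kw.
  move=> /(_ isT); rewrite -!addnS [k.+2%:R]mulrSr mulrDr mulr1; lra.
case: w w0 hw {no step} => // w _ hw /(_ w (ltnSn _)); lra.
Qed.

Hypothesis A0 : 0 < A.
Hypothesis h_growth : forall N, exists2 i, (N <= i)%N & h i <= A * i%:R + C.

(** Otherwise [h] would gain more than [2 A w] on every window of length [w],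
    hence grow at least like [2 A i]. *)
Lemma slow_window w : (0 < w)%N -> exists j, h (j + w) - h j <= 2 * A * w%:R.
Proof.
move=> w0; apply: contrapT => no.
have fast j : 2 * A * w%:R < h (j + w) - h j.
  by rewrite ltNge; apply/negP => hj; apply: no; exists j.
have lin k : h 0 + 2 * A * w%:R * k%:R <= h (k * w)%N.
  elim: k => [|k IH]; first by rewrite mulr0 addr0.
  have := fast (k * w)%N; rewrite addnC -mulSn [k.+1%:R]mulrSr mulrDr mulr1; lra.
(* Beyond [b] the lower bound [lin] exceeds the upper bound [A i + C]. *)
pose b := (C - h 0 + 2 * A * w%:R) / A.
have [i iN hi] := h_growth (Num.truncn `|b|).+1.
have bi : b < i%:R.
  apply: le_lt_trans (ler_norm _) _; apply: lt_le_trans (truncnS_gt _) _.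
  by rewrite ler_nat.
have {}bi : C - h 0 + 2 * A * w%:R < A * i%:R by rewrite [ltRHS]mulrC -ltr_pdivrMr.
have ik := scale_mono (leq_trunc_div i w).
have := lin (i %/ w)%N.
have iw : i%:R <= (i %/ w)%:R * w%:R + w%:R :> R.
  by rewrite -natrM -natrD ler_nat; have := divn_eq i w; have := ltn_pmod i w0; lia.
have : A * i%:R <= A * ((i %/ w)%:R * w%:R + w%:R) by rewrite ler_pM2l.
move=> ? ?; lra.
Qed.

(** Cut a slow window of length [3 w] into three equal parts: the first and the
    last one contain a slow step, and the middle one keeps them [w] apart. *)
Lemma select_scales w : (0 < w)%N -> exists i1 i2, [/\ (i1 + w <= i2)%N,
  h i1.+1 - h i1 <= 6 * A, h i2.+1 - h i2 <= 6 * A & h i2.+1 - h i1 <= 6 * A * w%:R].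
Proof.
move=> w0; have [|j hj] := @slow_window (3 * w); first by rewrite muln_gt0.
have {}hj : h (j + 3 * w)%N - h j <= 6 * A * w%:R by rewrite natrM in hj; lra.
have m1 := @scale_mono j (j + 2 * w) (leq_addr _ _).
have m2 := @scale_mono (j + w) (j + 3 * w) ltac:(lia).
have [|i1 /andP[ji1 i1j] h1] := @slow_step j w (6 * A) w0; first by lra.
have [|i2 /andP[ji2 i2j] h2] := @slow_step (j + 2 * w) w (6 * A) w0.
  by rewrite -addnA -mulSnr; lra.
exists i1, i2; split=> //; first by lia.
have := @scale_mono i2.+1 (j + 3 * w) ltac:(lia).
have := scale_mono ji1; lra.
Qed.

End Scales.

(** * Harmonic functions of polynomial growth on the group *)

Section PolynomialGrowth.
Context {R : realType} {G : groupType}.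
Variable S : {fset G}.
Local Notation gball := (gball S).
Local Notation letters := (letters S).
Implicit Types (x y t : G).

Lemma combination_harmonic n (u : 'I_n -> G -> R) (c : 'rV_n) :
  (forall a, group_harmonic S (u a)) -> group_harmonic S (combination u c).
Proof.
move=> hu x; rewrite (eq_bigr (fun t => \sum_a c 0 a * (u a (x * t)%g - u a x))).
  rewrite exchange_big big1 // => a _.
  by rewrite -mulr_sumr hu mulr0.
by move=> t _; rewrite -sumrB; apply: eq_bigr => a _; rewrite mulrBr.
Qed.

Lemma qform_gram_mono n (u : 'I_n -> G -> R) (m m' : nat) (c : 'rV_n) : (m <= m')%N ->
  qform (gram u (gball m)) c <= qform (gram u (gball m')) c.
Proof.
move=> mm'; rewrite !qform_gram.
apply: ler_sum_subseq; [exact: fset_uniq|exact: fset_uniq| |].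
  by move=> x; exact: gball_mono.
by move=> x; exact: sqr_ge0.
Qed.

Lemma det_gram_mono n (u : 'I_n -> G -> R) (m m' : nat) : (m <= m')%N ->
    posdef (gram u (gball m)) -> posdef (gram u (gball m')) ->
  0 < \det (gram u (gball m)) /\ \det (gram u (gball m)) <= \det (gram u (gball m')).
Proof.
move=> mm' p p'; have [|||d0] := @det_le_expr _ n 0 _ _ 0 1 p p'.
- by rewrite ler01 lexx.
- by move=> c; exact: qform_gram_mono.
- by move=> c _; rewrite mul1r; exact: qform_gram_mono.
by rewrite expr1n mul1r.
Qed.

(** A combination of the [u a] whose means over the balls of a cover all vanish
    decays by [harmonic_decay], and [packing] bounds the number of these linear
    conditions by [J]. *)
Lemma det_gram_decay n (u : 'I_n -> G -> R) r1 r2 J (K : R) :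
    (0 < r2)%N -> (6 * r1 <= r2)%N ->
    (size (gball (8 * r1)))%:R <= K * (size (gball r1))%:R ->
    (size (gball (r2 + r1)) <= J * size (gball r1))%N ->
    (forall a, group_harmonic S (u a)) ->
    posdef (gram u (gball r2)) -> posdef (gram u (gball (8 * r2))) ->
    8 * K ^+ 2 * (size letters)%:R * (r1%:R / r2%:R) ^+ 2 <= 1 ->
  \det (gram u (gball r2)) <=
  (8 * K ^+ 2 * (size letters)%:R * (r1%:R / r2%:R) ^+ 2) ^+ (n - J) *
  \det (gram u (gball (8 * r2))).
Proof.
move=> r20 r12 hK hJ hu p p'; set c := 8 * _ * _ * _ => c1.
have c0 : 0 <= c by rewrite mulr_ge0 ?sqr_ge0 // mulr_ge0 // mulr_ge0 ?sqr_ge0.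
have [X [uX Xr2 sX cX]] := exists_net S (2 * r1) (gball r2).
have XJ : (size X <= J)%N.
  rewrite -(leq_pmul2r (card_gball_gt0 S r1)); apply: leq_trans hJ.
  by apply: (@packing _ S r1 r2 1%g) => // x xX; rewrite invg1 mul1g Xr2.
pose L : 'M[R]_(n, size X) :=
  \matrix_(a, j) \sum_(b <- gball (2 * r1)) u a (nth 1%g X j * b)%g.
have [|||d0 dd] := det_le_expr (L := L) p p' (c := c).
- by rewrite c0 c1.
- by move=> x; apply: qform_gram_mono; rewrite leq_pmull.
- move=> v vL; rewrite !qform_gram.
  apply: (harmonic_decay r20 r12 hK uX sX Xr2 cX).
    exact: combination_harmonic.
  move=> x xX; have xs : (index x X < size X)%N by rewrite index_mem.
  have := congr1 (fun M : 'rV_(size X) => M 0 (Ordinal xs)) vL; rewrite !mxE /=.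
  move=> e; rewrite -[RHS]e /combination exchange_big /=.
  by apply: eq_bigr => a _; rewrite mxE /= nth_index // mulr_sumr.
apply: le_trans dd _; rewrite ler_wpM2r //.
  have [d0' _] := det_gram_mono (leqnn _) p' p'; exact: ltW.
by apply: ler_wiXn2l => //; rewrite leq_sub2l.
Qed.

Lemma le_expR_of_ln (x y b : R) : 0 < x -> 0 < y -> ln y - ln x <= b -> y <= expR b * x.
Proof.
move=> x0 y0; rewrite lerBlDr => xy.
by rewrite -[leLHS]lnK ?posrE // -[x]lnK ?posrE // -expRD ler_expR.
Qed.

(** Every entry is a sum of [|B(8^i)|] terms of size at most
    [(A (2 * 8^i)^d)^2]. Dividing the logarithm by [n] makes the rate in [i]
    independent of [n]. *)
Lemma ln_det_gram n (u : 'I_n -> G -> R) (d A : R) : (0 < n)%N -> 0 <= d -> 0 < A ->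
    (forall a m x, x \in gball m -> `|u a x| <= A * (1 + m%:R) `^ d) ->
  exists B, forall i, 0 < \det (gram u (gball (8 ^ i))) ->
    ln (\det (gram u (gball (8 ^ i)))) / n%:R <=
    ln (size (gball (8 ^ i)))%:R + 2 * d * ln 8 * i%:R + B.
Proof.
move=> n0 d0 A0 hA.
exists (ln n`!%:R / n%:R + 2 * ln A + 2 * d * ln 2) => i dpos.
set r := (8 ^ i)%N in dpos *.
have nR : 0 < n%:R :> R by rewrite ltr0n.
have V0 : 0 < (size (gball r))%:R :> R by rewrite ltr0n card_gball_gt0.
have f0 : 0 < n`!%:R :> R by rewrite ltr0n fact_gt0.
pose g : R := A * (2 * 8 ^+ i) `^ d.
have e0 : 0 < 2 * 8 ^+ i :> R by rewrite mulr_gt0 ?exprn_gt0.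
have p0 : 0 < (2 * 8 ^+ i) `^ d by rewrite powR_gt0.
have g0 : 0 < g by rewrite mulr_gt0.
have ug a x : x \in gball r -> `|u a x| <= g.
  move=> /hA /le_trans; apply; rewrite (ler_wpM2l (ltW A0)) // ge0_ler_powR ?nnegrE //.
  by rewrite /r natrX mulr_natl mulr2n lerD2r -natrX ler1n expn_gt0.
have entry a b : `|gram u (gball r) a b| <= (size (gball r))%:R * g ^+ 2.
  rewrite mxE; apply: le_trans (ler_norm_sum _ _ _) _.
  rewrite -sumr_seq_const big_seq [leRHS]big_seq; apply: ler_sum => x xr.
  by rewrite normrM expr2 ler_pM // ug.
have g2 : 0 < g ^+ 2 by exact: exprn_gt0.
have m0 : 0 < (size (gball r))%:R * g ^+ 2 by exact: mulr_gt0.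
have mn0 : 0 < ((size (gball r))%:R * g ^+ 2) ^+ n by exact: exprn_gt0.
have lng : ln g = ln A + d * (ln 2 + i%:R * ln 8).
  by rewrite /g lnM ?posrE // ln_powR lnM ?posrE ?exprn_gt0 // lnXn // mulr_natl.
have lnm : ln (n`!%:R * ((size (gball r))%:R * g ^+ 2) ^+ n) =
    ln n`!%:R + (ln (size (gball r))%:R + ln g *+ 2) *+ n.
  by rewrite lnM ?posrE // lnXn // lnM ?posrE // lnXn.
have : ln (\det (gram u (gball r))) <=
    ln (n`!%:R * ((size (gball r))%:R * g ^+ 2) ^+ n).
  by rewrite ler_ln ?posrE ?mulr_gt0 // det_le_fact.
rewrite lnm lng.
set v := ln (size _)%:R; set l := ln (\det _); set f := ln n`!%:R => hl.
rewrite ler_pdivrMr //; apply: le_trans hl _.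
rewrite le_eqVlt; apply/orP; left; apply/eqP.
rewrite -[_ *+ n]mulr_natr; field; exact: lt0r_neq0.
Qed.

Hypothesis S_generates : forall x, exists n, x \in gball n.

Lemma gball_exhaust n (g : 'I_n -> G) : exists m, forall i, g i \in gball m.
Proof.
have /choice[f fP] : forall i, exists m, g i \in gball m by move=> i.
exists (\max_i f i) => i; apply: gball_mono (fP i).
exact: (leq_bigmax (F := f)).
Qed.

(** The number [n] is fixed before the functions: it depends only on [rho], [d] and
    the number of letters, through the rate [al] of the quantity [h]. *)
Theorem harmonic_polynomial_growth_dependent (rho C d : R) : 0 <= rho -> 0 <= d ->
    (forall N, exists2 i, (N <= i)%N & ln (size (gball (8 ^ i)))%:R <= rho * i%:R + C) ->
  exists n : nat, forall (u : 'I_n -> G -> R) (g : 'I_n -> G) (A : R),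
    (forall a, group_harmonic S (u a)) -> 0 < A ->
    (forall a m x, x \in gball m -> `|u a x| <= A * (1 + m%:R) `^ d) ->
  \matrix_(i, j) u i (g j) \notin unitmx.
Proof.
move=> rho0 d0 growth.
pose al : R := 2 * rho + 2 * d * ln 8 + 1.
have ln8 : 0 < ln 8 :> R by rewrite ln_gt0 // ltr1n.
have al0 : 0 < al by rewrite ltr_wpDl // addr_ge0 ?mulr_ge0 // ltW.
pose a := 6 * al; pose K := expR a.
pose c0 := 8 * K ^+ 2 * (size letters)%:R.
(* [w] makes the contraction factor [c], at most [c0 / w], less than [expR (- 2 a)]. *)
pose w := (Num.truncn (c0 * expR (2 * a))).+1.
have K0 : 0 < K by exact: expR_gt0.
have c00 : 0 <= c0 by rewrite mulr_ge0 // mulr_ge0 ?sqr_ge0.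
(* [M] bounds the number of balls in the cover. *)
pose M := (Num.truncn (expR (a * w%:R))).+1.
exists (2 * M)%N => u g A hu A0 hA; apply/negP => gu.
set n := (2 * M)%N in u g hu hA gu *.
have n0 : (0 < n)%N by [].
have nR : 0 < n%:R :> R by rewrite ltr0n.
(* From radius [8^m] on, all the Gram matrices are positive definite. *)
have [m gm] := gball_exhaust g.
have pd i : posdef (gram u (gball (8 ^ (m + i)))).
  apply: gram_posdef gu => j; apply: gball_mono (gm j).
  by apply: leq_trans (leq_addr i m) _; apply/ltnW/ltn_expl.
pose V i : R := (size (gball (8 ^ (m + i))))%:R.
pose D i := \det (gram u (gball (8 ^ (m + i)))).
have le8 i : (8 ^ (m + i) <= 8 ^ (m + i.+1))%N by rewrite leq_exp2l // leq_add2l.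
have V0 i : 0 < V i by rewrite ltr0n card_gball_gt0.
have Vm i : ln (V i) <= ln (V i.+1).
  by rewrite ler_ln ?posrE // ler_nat card_gball_mono.
have D0 i : 0 < D i by have [] := det_gram_mono (le8 i) (pd i) (pd i.+1).
have Dm i : ln (D i) <= ln (D i.+1).
  by rewrite ler_ln ?posrE //; have [] := det_gram_mono (le8 i) (pd i) (pd i.+1).
pose h i := ln (V i) + ln (D i) / n%:R.
have hm i : h i <= h i.+1 by rewrite lerD // ler_pM2r ?invr_gt0.
have [B hB] := ln_det_gram n0 d0 A0 hA.
have hg N : exists2 i, (N <= i)%N & h i <= al * i%:R + (al * m%:R + 2 * `|C| + B).
  have [j Nj hj] := growth (m + N)%N; have mj := leq_trans (leq_addr _ _) Nj.
  exists (j - m)%N; first by rewrite leq_subRL.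
  have jE : (m + (j - m) = j)%N by rewrite subnKC.
  rewrite /h /V /D jE; have := hB j; rewrite -{1}jE => /(_ (D0 _)).
  have -> : al * (j - m)%:R + (al * m%:R + 2 * `|C| + B) = al * j%:R + 2 * `|C| + B.
    by rewrite -[in RHS]jE natrD; ring.
  have := ler_norm C; have : 0 <= j%:R :> R by []; rewrite /al => ? ? ?; lra.
have w0 : (0 < w)%N by [].
have [i1 [i2 [i12 s1 s2 s12]]] := select_scales hm al0 hg w0.
pose r1 := (8 ^ (m + i1))%N; pose r2 := (8 ^ (m + i2))%N.
have r8 i : (8 ^ (m + i.+1) = 8 * 8 ^ (m + i))%N by rewrite addnS expnS.
have r12 : (r1 * 8 ^ w <= r2)%N by rewrite -expnD leq_exp2l // -addnA leq_add2l.
have r1pos : (0 < r1)%N by rewrite expn_gt0.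
have r2pos : (0 < r2)%N by rewrite expn_gt0.
have w8 : (8 <= 8 ^ w)%N by rewrite -{1}[8%N]expn1 leq_exp2l.
have r68 : (6 * r1 <= r2)%N.
  by apply: leq_trans r12; rewrite mulnC leq_mul2l (leq_trans _ w8) ?orbT.
have r1r2 : (r1 <= r2)%N by apply: leq_trans r68; exact: leq_pmull.
have Dn i : ln (D i.+1) / n%:R - ln (D i) / n%:R >= 0.
  by rewrite subr_ge0 ler_pM2r ?invr_gt0.
have hK : (size (gball (8 * r1)))%:R <= K * (size (gball r1))%:R.
  rewrite -r8; apply: le_expR_of_ln; [exact: V0|exact: V0|].
  by apply: le_trans s1; rewrite /h; have := Dn i1; rewrite /V; lra.
have hJ : (size (gball (r2 + r1)) <= M * size (gball r1))%N.
  rewrite -(ler_nat R) natrM.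
  apply: (@le_trans _ _ (V i2.+1)).
    rewrite ler_nat card_gball_mono // r8 -/r2 mulSn leq_add2l.
    exact: leq_trans r1r2 (leq_pmull _ _).
  apply: (@le_trans _ _ (expR (a * w%:R) * V i1)).
    apply: le_expR_of_ln => //; apply: le_trans s12; rewrite /h.
    have i12' : (i1 <= i2.+1)%N by apply: leq_trans (leqW i12); exact: leq_addr.
    have Dh : ln (D i1) <= ln (D i2.+1).
      by apply: (@scale_mono R (fun i => ln (D i))).
    have : ln (D i1) / n%:R <= ln (D i2.+1) / n%:R by rewrite ler_pM2r ?invr_gt0.
    by lra.
  by rewrite ler_pM2r //; apply/ltW/truncnS_gt.
set c := c0 * (r1%:R / r2%:R) ^+ 2.
(* [r1 / r2 <= 8^- w <= w^-1]. *)
have cw : c * expR (2 * a) < 1.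
  have r2R : 0 < r2%:R :> R by rewrite ltr0n.
  have q : (r1%:R / r2%:R) ^+ 2 <= (w%:R)^-1 :> R.
    have wR : 0 < w%:R :> R by rewrite ltr0n.
    have q0 : r1%:R / r2%:R <= (w%:R)^-1 :> R.
      rewrite ler_pdivrMr // mulrC ler_pdivlMr // -natrM ler_nat.
      by apply: leq_trans r12; rewrite leq_mul2l (ltnW (ltn_expl _ _)) ?orbT.
    apply: le_trans q0; rewrite expr2 ler_piMl ?divr_ge0 // ler_pdivrMr // mul1r.
    by rewrite ler_nat.
  apply: (@le_lt_trans _ _ (c0 * (w%:R)^-1 * expR (2 * a))).
    by rewrite ler_pM2r ?expR_gt0 // ler_wpM2l.
  rewrite mulrAC ltr_pdivrMr ?ltr0n // mul1r; exact: truncnS_gt.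
have cpos : 0 <= c by rewrite mulr_ge0 // sqr_ge0.
have c1 : c <= 1.
  apply: le_trans (ltW cw); rewrite ler_peMr // -expR0 ler_expR mulr_ge0 //.
  by rewrite mulr_ge0 // ltW.
have := @det_gram_decay n u r1 r2 M K r2pos r68 hK hJ hu (pd i2).
rewrite -/c0 -r8 => /(_ (pd i2.+1) c1); rewrite -/c -/(D i2) -/(D i2.+1).
have -> : (n - M = M)%N by rewrite /n mul2n -addnn addnK.
have DD : D i2.+1 <= expR (2 * a) ^+ M * D i2.
  rewrite -expRM_natl; apply: le_expR_of_ln => //.
  have : ln (D i2.+1) / n%:R - ln (D i2) / n%:R <= a.
    by apply: le_trans s2; rewrite /h; have := Vm i2; lra.
  rewrite -mulrBl ler_pdivrMr // /n natrM => /le_trans; apply.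
  by rewrite -mulr_natl; lra.
have q1 : (c * expR (2 * a)) ^+ M < 1.
  by rewrite exprn_ilt1 // mulr_ge0 // expR_ge0.
move=> hD; have : D i2 <= (c * expR (2 * a)) ^+ M * D i2.
  apply: le_trans hD _; rewrite [X in _ <= X * _]exprMn -[leRHS]mulrA.
  by apply: ler_wpM2l DD; exact: exprn_ge0.
by apply/negP; rewrite -ltNge gtr_pMl.
Qed.

End PolynomialGrowth.

(** * Balls of a Cayley graph and weakly polynomial growth *)

Section Growth.
Context {R : realType} {G : groupType}.
Implicit Types (S : {fset G}) (x : G) (w : seq G).

Lemma word_in_gball S x w : word_for S x w -> x \in gball S (size w).
Proof.
case=> aw <-; elim: w aw => [_|t w IH]; first by rewrite big_nil gball1.
case/andP => /orP tS /IH wS; rewrite big_cons -[size _]add1n; apply: gballM => //.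
rewrite -[t]mul1g; apply: gball_mul_letter; first exact: gball1.
exact/letterP.
Qed.

Lemma generates_gball S : generates S -> forall x, exists n, x \in gball S n.
Proof. by move=> gS x; have [w /word_in_gball] := gS x; exists (size w). Qed.

Lemma word_norm_le S x w : word_for S x w -> word_norm (R := R) S x <= (size w)%:R.
Proof.
move=> xw; apply: ge_inf; last by exists w.
by exists 0 => _ [v _ <-].
Qed.

(** Each letter of [S] is a word of bounded length in [S0]. *)
Lemma gball_sub_word_ball S0 S : generates S0 ->
  exists2 k : nat, (0 < k)%N &
    forall n x, x \in gball S n -> word_ball (R := R) S0 (k * n)%:R x.
Proof.
move=> gS0; have /choice[W WP] : forall x, exists w, word_for S0 x w by exact: gS0.
pose k := (\max_(t <- letters S) size (W t)).+1; exists k => // n x xn.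
suff [w wx wn] : exists2 w, word_for S0 x w & (size w <= k * n)%N.
  by apply: le_trans (word_norm_le wx) _; rewrite ler_nat.
elim: n x xn => [|n IH] x.
  by rewrite /= inE => /eqP ->; exists [::] => //; split; rewrite ?big_nil.
case/gballSP => [/IH[w wx wn]|[y /IH[w [aw wy] wn] yx]].
  by exists w => //; apply: leq_trans wn _; rewrite leq_mul2l leqnSn orbT.
set t := (y^-1 * x)%g in yx; have [at_ wt] := WP t.
exists (w ++ W t).
  by split; rewrite ?all_cat ?aw // big_cat /= wy wt mulVKg.
rewrite size_cat mulnS addnC leq_add // /k leqW //.
by rewrite (big_rem t) //= leq_maxl.
Qed.

Lemma le_counting (B : {fset G}) (A : set G) : [set` B] `<=` A ->
  ((size B)%:R%:E <= counting A :> \bar R)%E.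
Proof.
move=> BA; rewrite /counting; case: asboolP => [fA|_]; last exact: leey.
rewrite lee_fin ler_nat; apply: uniq_leq_size; first exact: fset_uniq.
by move=> x xB; rewrite [_ \in _](in_fset_set fA) inE; apply: BA.
Qed.

(** Rounding down to a power of 8 the radii given by the lower limit costs only
    a constant factor. *)
Lemma weak_growth_gball S0 S : generates S0 -> weakly_polynomial_growth R S0 ->
  exists rho C : R, 0 <= rho /\ forall N,
    exists2 i, (N <= i)%N & ln (size (gball S (8 ^ i)))%:R <= rho * i%:R + C.
Proof.
move=> gS0 [d d0]; rewrite limf_einfE; set s := ereal_sup _ => sfin.
have [k k0 kS] := @gball_sub_word_ball S0 S gS0.
have [M M0 sM] : exists2 M : R, 0 < M & (s < M%:E)%E.
  case: s sfin => [r _|//|_]; last by exists 1; rewrite ?ltNyr.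
  exists (`|r| + 1); first by rewrite ltr_wpDl.
  by rewrite lte_fin; have := ler_norm r; lra.
exists (d * ln 8), (ln M + d * (ln 8 + ln k%:R)).
have ln8 : 0 < ln 8 :> R by rewrite ln_gt0 // ltr1n.
split; first by rewrite mulr_ge0 // ltW.
move=> N.
have kR : 0 < k%:R :> R by rewrite ltr0n.
pose V := [set r : R | k%:R * 8 ^+ N < r].
have /ereal_inf_lt[_ [r /= Vr <-] cM] : (ereal_inf ((fun r : R =>
    counting (word_ball S0 r) * ((r `^ d)^-1)%:E) @` V) < M%:E)%E.
  apply: le_lt_trans sM; apply: ereal_sup_ubound; exists V => //.
  by exists (k%:R * 8 ^+ N); split=> //; rewrite num_real.
have r0 : 0 < r by apply: lt_trans Vr; rewrite mulr_gt0 ?exprn_gt0.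
have rd0 : 0 < r `^ d by rewrite powR_gt0.
pose n := Num.truncn (r / k%:R).
have nr : n%:R <= r / k%:R by rewrite truncn_le // divr_ge0 // ltW.
have rn : r / k%:R < n.+1%:R by exact: truncnS_gt.
have Nn : (8 ^ N <= n)%N.
  rewrite -ltnS -(ltr_nat R); apply: le_lt_trans rn.
  by rewrite ler_pdivlMr // natrX mulrC ltW.
have n0 : (0 < n)%N by apply: leq_trans Nn; rewrite expn_gt0.
have /andP[in1 in2] := trunc_log_bounds (isT : (1 < 8)%N) n0.
set i := trunc_log 8 n in in1 in2.
exists i; first by apply: trunc_log_max.
have sub : [set` gball S (8 ^ i)] `<=` word_ball (R := R) S0 r.
  move=> x /kS xk; apply: le_trans xk _.
  rewrite natrM mulrC -ler_pdivlMr //; apply: le_trans nr.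
  by rewrite ler_nat.
set B := (size _)%:R.
have B0 : 0 < B :> R by rewrite ltr0n card_gball_gt0.
have BM : B <= M * r `^ d.
  rewrite -ler_pdivrMr // -lee_fin EFinM; apply: le_trans (ltW cM).
  by rewrite lee_pmul2r ?lte_fin ?invr_gt0 //; exact: le_counting.
apply: le_trans (_ : ln (M * r `^ d) <= _).
  by rewrite ler_ln ?posrE // mulr_gt0.
rewrite lnM ?posrE // ln_powR.
have rle : ln r <= (i%:R + 1) * ln 8 + ln k%:R.
  have rk : r <= 8 ^+ i.+1 * k%:R.
    rewrite -ler_pdivrMr //; apply: le_trans (ltW rn) _.
    by rewrite -natrX ler_nat.
  apply: le_trans (_ : ln (8 ^+ i.+1 * k%:R) <= _).
    by rewrite ler_ln ?posrE // mulr_gt0 ?exprn_gt0.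
  by rewrite lnM ?posrE ?exprn_gt0 // lnXn // natr1 mulr_natl.
have : d * ln r <= d * ((i%:R + 1) * ln 8 + ln k%:R) by rewrite ler_pM2l.
by rewrite !mulrDr !mulrDl; lra.
Qed.

End Growth.

(** * Harmonic functions on the Cayley graph *)

Section CayleyGraph.
Context {R : realType} {G : groupType} {S : {fset G}}.
Local Notation Gamma := (cayley R S).
Local Notation vertex := (Vertex R S).
Implicit Types (u v : Gamma -> R) (x y : Gamma).

Lemma pl_path_ge0 x y l : pl_path x y l -> 0 <= l.
Proof. by elim=> // *; rewrite addr_ge0. Qed.

Lemma cayley_dist_le x y l : pl_path x y l -> cayley_dist x y <= l.
Proof.
move=> p; apply: ge_inf => //.
by exists 0 => r /= /pl_path_ge0.
Qed.

Lemma cayley_dist_ge0 x y : 0 <= cayley_dist x y.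
Proof.
rewrite /cayley_dist; set E := [set l | _].
have [[l El]|/nonemptyPn E0] := pselect (E !=set0).
  by apply: lb_le_inf => [|r /pl_path_ge0 //]; exists l.
by rewrite E0 inf0.
Qed.

Lemma pl_path_trans x y z l m : pl_path x y l -> pl_path y z m -> pl_path x z (l + m).
Proof.
elim=> [x'|g s a b y' l' a01 b01 _ IH] p; first by rewrite add0r.
by rewrite -addrA; apply: pl_path_cons => //; exact: IH.
Qed.

Lemma edge_outside g (s : S) (t : R) : ~~ (0 < t < 1) ->
  edge g s t = vertex (if t <= 0 then g else (g * val s)%g).
Proof. by move=> t01; rewrite /edge insubN. Qed.

Lemma edge0 g (s : S) : edge g s (0 : R) = vertex g.
Proof. by rewrite edge_outside ?ltxx // lexx. Qed.

Lemma edge1 g (s : S) : edge g s (1 : R) = vertex (g * val s)%g.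
Proof. by rewrite edge_outside ?ltxx ?andbF // ler10. Qed.

Lemma pl_path_edge g (s : S) (a b : R) : 0 <= a <= 1 -> 0 <= b <= 1 ->
  pl_path (edge g s a) (edge g s b) `|a - b|.
Proof.
by move=> a01 b01; rewrite -[X in pl_path _ _ X]addr0; apply: pl_path_cons => //; exact: pl_path_nil.
Qed.

Lemma pl_path_letter g t : t \in letters S ->
  pl_path (vertex g) (vertex (g * t)%g) 1.
Proof.
have e0 : 0 <= (0 : R) <= 1 by rewrite lexx ler01.
have e1 : 0 <= (1 : R) <= 1 by rewrite lexx ler01.
case/letterP => tS.
  have := pl_path_edge g (FSetSub tS) e0 e1.
  by rewrite edge0 edge1 sub0r normrN1.
have := pl_path_edge (g * t)%g (FSetSub tS) e1 e0.
by rewrite edge0 edge1 subr0 normr1 /= mulgK.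
Qed.

Lemma cayley_dist_gball n g : g \in gball S n ->
  cayley_dist (vertex 1%g) (vertex g) <= n%:R.
Proof.
suff h : g \in gball S n -> exists2 l, l <= n%:R & pl_path (vertex 1%g) (vertex g) l.
  by move=> /h[l ln /cayley_dist_le dl]; exact: le_trans dl ln.
elim: n g => [|n IH] g.
  by rewrite /= inE => /eqP ->; exists 0 => //; exact: pl_path_nil.
case/gballSP => [/IH[l ln p]|[y /IH[l ln p] yg]].
  by exists l => //; apply: le_trans ln _; rewrite ler_nat.
exists (l + 1); first by rewrite -natr1 lerD2r.
by apply: pl_path_trans p _; have := pl_path_letter y yg; rewrite mulVKg.
Qed.

Lemma polynomial_growth_gball (d : R) u : 0 <= d -> polynomial_growth_at_most S d u ->
  exists2 A, 0 < A &
    forall n g, g \in gball S n -> `|u (vertex g)| <= A * (1 + n%:R) `^ d.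
Proof.
move=> d0 [A hA]; exists (`|A| + 1); first by rewrite ltr_wpDl.
move=> n g gn; apply: le_trans (hA _) _.
apply: (@le_trans _ _ ((`|A| + 1) *
    (1 + cayley_dist (vertex 1%g) (vertex g)) `^ d)).
  by rewrite ler_wpM2r ?powR_ge0 //; have := ler_norm A; lra.
rewrite ler_wpM2l ?addr_ge0 // ge0_ler_powR ?nnegrE ?addr_ge0 ?cayley_dist_ge0 //.
by rewrite lerD2l cayley_dist_gball.
Qed.

Lemma adjacent_letters (g : G) :
  [set h | cayley_adjacent S g h] = [set` [seq (g * t)%g | t <- letters S]].
Proof.
apply/seteqP; split=> h /=.
  case=> s sS [->|->]; apply/mapP.
    by exists s => //; apply/letterP; left.
  exists (s^-1)%g; last by rewrite mulgK.
  by apply/letterP; right; rewrite invgK.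
case/mapP => t /letterP[tS|tS] ->; first by exists t => //; left.
by exists (t^-1)%g => //; right; rewrite mulgK.
Qed.

Lemma vertex_sum (F : G -> R) (g : G) :
  \sum_(h \in [set h | cayley_adjacent S g h]) F h =
  \sum_(t <- letters S) F (g * t)%g.
Proof.
rewrite adjacent_letters -fsbig_seq ?big_map //.
by rewrite map_inj_uniq ?fset_uniq //; exact: mulgI.
Qed.

Lemma cayley_harmonic_group u : cayley_harmonic S u ->
  group_harmonic S (fun g => u (vertex g)).
Proof.
case=> _ _ hu g.
by rewrite -(vertex_sum (fun h => u (vertex h) - u (vertex g))) hu.
Qed.

End CayleyGraph.

Section HarmonicSpace.
Context {R : realType} {G : groupType} {S : {fset G}}.
Local Notation Gamma := (cayley R S).
Local Notation vertex := (Vertex R S).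
Implicit Types (u v : Gamma -> R) (x y : Gamma).

Lemma cayley_harmonic0 : cayley_harmonic S (0 : Gamma -> R).
Proof.
split.
- by move=> x e e0; exists 1 => // y _; rewrite subrr normr0.
- by move=> g s; exists 0 => t _; exact: is_derive_cst.
by move=> g; rewrite vertex_sum big1 // => t _; rewrite subrr.
Qed.

Lemma cayley_continuousP a u v : cayley_continuous u -> cayley_continuous v ->
  cayley_continuous (a *: u + v).
Proof.
move=> cu cv x e e0.
have a0 : 0 < `|a| + 1 by rewrite ltr_wpDl.
have q0 : 0 < e / 2 / (`|a| + 1) by rewrite !divr_gt0.
have [r r0 ur] := cu x _ q0; have [r' r'0 vr] := cv x _ (divr_gt0 e0 (ltr0n _ 2)).
exists (Num.min r r'); first by rewrite lt_min r0.
move=> y; rewrite lt_min => /andP[/ur uxy /vr vxy]; rewrite !fctE.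
have -> : a *: u x + v x - (a *: u y + v y) = a * (u x - u y) + (v x - v y).
  by rewrite -[a *: u x]/(a * u x) -[a *: u y]/(a * u y); ring.
apply: le_lt_trans (ler_normD _ _) _; rewrite normrM [ltRHS]splitr.
apply: ler_ltD vxy; apply: (@le_trans _ _ ((`|a| + 1) * (e / 2 / (`|a| + 1)))).
  by rewrite ler_pM // ?lerDl // ltW.
by rewrite mulrC divfK // gt_eqF.
Qed.

Lemma cayley_harmonicP a u v : cayley_harmonic S u -> cayley_harmonic S v ->
  cayley_harmonic S (a *: u + v).
Proof.
move=> [cu du hu] [cv dv hv]; split.
- exact: cayley_continuousP.
- move=> g s; have [c hc] := du g s; have [c' hc'] := dv g s.
  exists (a * c + c') => t t01.
  have := hc t t01; have := hc' t t01 => dv' du'.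
  exact: is_deriveD.
move=> g; rewrite vertex_sum.
transitivity (a * (\sum_(t <- letters S) (u (vertex (g * t)%g) - u (vertex g))) +
    \sum_(t <- letters S) (v (vertex (g * t)%g) - v (vertex g))).
  rewrite mulr_sumr -big_split /=; apply: eq_bigr => t _.
  by rewrite !fctE -[a *: u _]/(a * u _) -[a *: u (vertex g)]/(a * u (vertex g)); ring.
rewrite -(vertex_sum (fun h => u (vertex h) - u (vertex g))) hu.
by rewrite -(vertex_sum (fun h => v (vertex h) - v (vertex g))) hv mulr0 addr0.
Qed.

Lemma polynomial_growthP (d : R) a u v : polynomial_growth_at_most S d u ->
  polynomial_growth_at_most S d v -> polynomial_growth_at_most S d (a *: u + v).
Proof.
move=> [A uA] [B vB]; exists (`|a| * A + B) => x.
rewrite !fctE; apply: le_trans (ler_normD _ _) _.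
rewrite mulrDl lerD // normrM -mulrA ler_wpM2l //; exact: uA.
Qed.

Definition growing_harmonic (d : R) : set (Gamma -> R) :=
  [set u | cayley_harmonic S u /\ polynomial_growth_at_most S d u].

Lemma growing_harmonic_submod d : submod_closed [in growing_harmonic d].
Proof.
split; first by rewrite inE; split; [exact: cayley_harmonic0|]; exists 0 => x; rewrite normr0 mul0r.
move=> a u v; rewrite !inE => -[hu gu] [hv gv].
by split; [exact: cayley_harmonicP|exact: polynomial_growthP].
Qed.

(** Outside [0, 1] an edge is extended by constants, so that functions of its
    parameter are continuous on the whole line. *)
Lemma edge_clamp g (s : S) (t : R) : edge g s t = edge g s (Num.max 0 (Num.min t 1)).
Proof.
have [t0|t0] := leP t 0.
  rewrite (min_idPl (le_trans t0 ler01)) (max_idPl t0) edge0 edge_outside ?t0 //.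
  by rewrite negb_and -leNgt t0.
have [t1|t1] := ltP t 1; first by rewrite (max_idPr (ltW t0)).
rewrite (max_idPr ler01) edge1 edge_outside; last by rewrite negb_and -!leNgt t1 orbT.
by rewrite leNgt t0.
Qed.

Lemma clamp01 (t : R) : 0 <= Num.max 0 (Num.min t 1) <= 1.
Proof. by rewrite le_max lexx /= ge_max ler01 ge_min lexx orbT. Qed.

Lemma clamp_lipschitz (s t : R) :
  `|Num.max 0 (Num.min s 1) - Num.max 0 (Num.min t 1)| <= `|s - t|.
Proof.
have st := ler_norm (s - t); have := ler_norm (t - s); rewrite distrC => ts.
rewrite ler_norml; apply/andP.
case: (leP s 1) => ?; case: (leP t 1) => ?; case: (leP 0 s) => ?; case: (leP 0 t) => ?;
  rewrite ?(max_idPr ler01); split; lra.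
Qed.

Lemma edge_continuous u g (s : S) : cayley_continuous u ->
  continuous (fun t : R => u (edge g s t)).
Proof.
move=> cu t; apply/cvgrPdist_lt => e e0; have [r r0 ur] := cu (edge g s t) e e0.
near=> t'; apply: ur.
rewrite (edge_clamp g s t) (edge_clamp g s t').
apply: le_lt_trans (cayley_dist_le (pl_path_edge g s (clamp01 t) (clamp01 t'))) _.
apply: le_lt_trans (clamp_lipschitz t t') _.
by near: t'; apply: cvgr_dist_lt.
Unshelve. all: by end_near.
Qed.

(** On each edge the mean value theorem makes [u] affine, and both endpoints
    have the value 0. *)
Lemma harmonic_vertex_eq0 u : cayley_harmonic S u -> (forall g, u (vertex g) = 0) -> u = 0.
Proof.
move=> [cu du _] u0; apply/funext => -[g|g s [t t01]]; first exact: u0.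
have e t' : (t' == 0) || (t' == 1) -> u (edge g s t') = 0.
  by case/orP => /eqP ->; rewrite ?edge0 ?edge1 u0.
have -> : EdgePoint g s (exist _ t t01) = edge g s t.
  by rewrite /edge insubT.
have [c hc] := du g s.
have ct : forall a b : R, {within `[a, b], continuous (fun t => u (edge g s t))}.
  by move=> a b; apply: continuous_subspaceT; exact: edge_continuous.
have slope b : 0 < b <= 1 -> u (edge g s b) = c * b.
  case/andP => b0 b1; have [||z _] := @MVT R (fun t => u (edge g s t)) (fun=> c) 0 b b0.
  - move=> z; rewrite in_itv /= => /andP[z0 zb]; apply: hc.
    by rewrite z0 (lt_le_trans zb b1).
  - exact: ct.
  by rewrite (e 0) ?eqxx // !subr0.
have := slope 1; rewrite ltr01 lexx e ?eqxx ?orbT // mulr1 => /(_ isT) /esym c0.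
by rewrite slope ?c0 ?mul0r //; case/andP: t01 => -> /ltW.
Qed.

End HarmonicSpace.

(** * Finite dimension from bounded rank *)

(** Take functions [u_1, ..., u_k] of [V] and points [g_1, ..., g_k] with an
    invertible matrix of values and [k] maximal. For [v] in [V], subtract the
    combination of the [u_i] that agrees with [v] at the [g_j]. If the difference
    were nonzero at some [y], adding it and [y] would give an invertible block
    triangular matrix of size [k + 1]. *)
Lemma finite_dimensional_of_rank (R : realType) (X Y : Type) (iota : Y -> X)
    (V : set (X -> R)) (n : nat) :
    submod_closed [in V] ->
    (forall v, V v -> (forall y, v (iota y) = 0) -> v = 0) ->
    (forall (u : 'I_n -> X -> R) (g : 'I_n -> Y), (forall i, V (u i)) ->
      \matrix_(i, j) u i (iota (g j)) \notin unitmx) ->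
  finite_dimensional_subspace V.
Proof.
move=> Vsub Vinj Vrank; split=> //.
have VD a u v : V u -> V v -> V (a *: u + v).
  by have [_ h] := Vsub; move=> Vu Vv; have := h a u v; rewrite !inE; apply.
pose P k := exists (u : 'I_k -> X -> R) (g : 'I_k -> Y), (forall i, V (u i)) /\
  \matrix_(i, j) u i (iota (g j)) \in unitmx.
(* [P 0] holds by the empty matrix and [P n] fails, so [k] is where it stops. *)
have [k [[u [g [Vu gu]]] Pk]] : exists k, P k /\ ~ P k.+1.
  apply: contrapT => no; have Pall k : P k.
    elim: k => [|k IH]; last by apply: contrapT => Pk; apply: no; exists k.
    exists (fun=> 0); exists (fun i : 'I_0 => match notF (ltn_ord i) with end).
    by split=> [[]//|]; rewrite unitmxE det_mx00 unitr1.
  have [u [g [Vu gu]]] := Pall n.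
  by have := Vrank u g Vu; rewrite gu.
exists k, u; split=> // v Vv.
set M := \matrix_(i, j) _ in gu.
pose c := (\row_j v (iota (g j))) *m invmx M.
exists (fun i => c 0 i); apply/eqP; rewrite -subr_eq0; apply/eqP.
set w := v - _.
have Vw : V w.
  rewrite /w; elim/big_rec: _ => [|i z _ Vz]; first by rewrite subr0.
  rewrite opprD addrCA -scaleNr; exact: VD.
have wg j : w (iota (g j)) = 0.
  rewrite /w !fctE fct_sumE; apply/eqP; rewrite subr_eq0; apply/eqP.
  have := congr1 (fun A : 'rV_k => A 0 j) (mulmxKV gu (\row_j v (iota (g j)))).
  by rewrite -/c [LHS]mxE [RHS]mxE => <-; apply: eq_bigr => i _; rewrite [M i j]mxE.
apply: Vinj => // y; apply: contrapT => wy; apply: Pk.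
pose u' (i : 'I_(1 + k)) := if fintype.split i is inr j then u j else w.
pose g' (i : 'I_(1 + k)) := if fintype.split i is inr j then g j else y.
exists u', g'; split; first by move=> i; rewrite /u'; case: fintype.split.
pose B : 'M[R]_(1 + k) := block_mx (w (iota y))%:M 0 (\col_i u i (iota y)) M.
have Bu : B \in unitmx.
  rewrite unitmxE det_lblock det_scalar1 unitrM -[\det M \is a _]unitmxE gu andbT.
  by rewrite unitfE; apply/eqP.
suff -> : \matrix_(i, j) u' i (iota (g' j)) = B by exact: Bu.
apply/matrixP => i j; rewrite !mxE /u' /g'.
case: fintype.split => i'; rewrite !mxE; case: fintype.split => j'; rewrite !mxE //.
by rewrite !ord1 eqxx mulr1n.
Qed.

Theorem theorem1p4 (R : realType) (G : groupType) (S0 S : {fset G}) (d : R) :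
  generates S0 -> weakly_polynomial_growth R S0 ->
  generates S -> 0 <= d ->
  finite_dimensional_subspace
    [set u : cayley R S -> R | cayley_harmonic S u /\ polynomial_growth_at_most S d u].
Proof.
move=> gS0 wS0 gS d0.
have [rho [C [rho0 growth]]] := weak_growth_gball S gS0 wS0.
have [n dep] := harmonic_polynomial_growth_dependent (generates_gball gS) rho0 d0 growth.
apply: (@finite_dimensional_of_rank _ _ _ (Vertex R S) _ n).
- exact: growing_harmonic_submod.
- by move=> u [hu _]; exact: harmonic_vertex_eq0.
move=> u g Vu.
have /choice[A AP] : forall i, exists A, 0 < A /\
    forall m x, x \in gball S m -> `|u i (Vertex R S x)| <= A * (1 + m%:R) `^ d.
  by move=> i; have [_ /(polynomial_growth_gball d0)[A A0 hA]] := Vu i; exists A.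
apply: (dep (fun i x => u i (Vertex R S x)) g (1 + \sum_i A i)).
- by move=> i; apply: cayley_harmonic_group; have [] := Vu i.
- by rewrite ltr_pwDl // sumr_ge0 // => i _; have [/ltW] := AP i.
move=> i m x xm; have [_ /(_ m x xm) h] := AP i; apply: le_trans h _.
rewrite ler_wpM2r ?powR_ge0 // (bigD1 i) //= addrCA lerDl addr_ge0 //.
by rewrite sumr_ge0 // => j _; have [/ltW] := AP j.
Qed.
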